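(* Let $0<\rho\le r\le R$ and let $\Omega\subseteq\mathbb{R}^n$ be a domain contained in the open ball $\mathbb{B}_R(0)$, containing the open ball $\mathbb{B}_r(0)$, and star-shaped with respect to the open ball $\mathbb{B}_\rho(0)$. Let $s$ and $\mathbf{S}$ be the expansion function and expansion transformation of $\Omega$. Then $\mathbf{S}$ is bi-Lipschitz. Letting $\nabla_S s$ denote the surface gradient of $s$ over the unit sphere, and writing $\hat x=x/\|x\|$, the Jacobian of $\mathbf{S}$ has at almost every $x\in\mathbb{R}^n$ the form $$ \mathbf{J}\mathbf{S}(x)=s(\hat x)\,\mathrm{Id}_n+\hat x\otimes\nabla_S s(\hat x). $$ At almost every $x\in\mathbb{R}^n$, the singular values of $\mathbf{J}\mathbf{S}(x)$ are $$ \sigma_1(x)=\tfrac12\left(\sqrt{4s(\hat x)^2+\|\nabla_S s(\hat x)\|^2}+\|\nabla_S s(\hat x)\|\right), $$ $$ \sigma_2(x)=\dots=\sigma_{n-1}(x)=s(\hat x), $$ $$ \sigma_n(x)=\tfrac12\left(\sqrt{4s(\hat x)^2+\|\nabla_S s(\hat x)\|^2}-\|\nabla_S s(\hat x)\|\right). $$ In particular, almost everywhere $$ \det\mathbf{J}\mathbf{S}(x)=s(\hat x)^n. $$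
   Context: A domain is an open connected set. $\mathbb{B}_t(0)$ is the open Euclidean ball of radius $t$ about the origin and $\|\cdot\|$ the Euclidean norm. $\Omega$ is star-shaped with respect to a subset $B\subseteq\Omega$ if for all $x\in\Omega$, $x_0\in B$, $\lambda\in[0,1]$ one has $(1-\lambda)x+\lambda x_0\in\Omega$. Expansion function on the unit sphere: $s(\hat u):=\sup\{t>0: t\hat u\in\Omega\}$ for unit vectors $\hat u$. Expansion transformation: $\mathbf{S}:\mathbb{R}^n\to\mathbb{R}^n$, $\mathbf{S}(x):=s(x/\|x\|)\,x$ for $x\neq0$, $\mathbf{S}(0):=0$. The function $s$ is Lipschitz on the unit sphere, so its surface (tangential, spherical) gradient $\nabla_Ss(\hat x)\in\mathbb{R}^n$, a vector orthogonal to $\hat x$, exists at almost every point of the sphere with respect to surface measure. $\mathbf{J}$ denotes the Jacobian matrix, $\mathrm{Id}_n$ the identity matrix, and $(a\otimes b)v=(b\cdot v)\,a$. *)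

(* Defs.v *)
From mathcomp Require Import all_boot all_order all_algebra.
From mathcomp Require Import all_classical all_reals all_analysis.

Set Implicit Arguments.
Unset Strict Implicit.
Unset Printing Implicit Defensive.

Import Order.TTheory GRing.Theory Num.Theory.
Import numFieldNormedType.Exports.

Local Open Scope classical_set_scope.
Local Open Scope ring_scope.

(* Points of R^n are row vectors 'rV[R]_n. The norm `|x| that the library puts
   on matrices is the sup norm, so the Euclidean one is defined here; both
   induce the same topology and the same notion of differentiability. *)

Section Euclidean.
Variables (R : realType) (n : nat).
Implicit Types (x y u v g : 'rV[R]_n) (t : R).

Definition dotp x y : R := \sum_(i < n) x 0 i * y 0 i.

Definition enorm x : R := Num.sqrt (dotp x x).

Definition eball t : set 'rV[R]_n := [set x | enorm x < t].

Definition unit_vec x : 'rV[R]_n := (enorm x)^-1 *: x.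

(* The matrix whose action on column vectors is v |-> (b . v) a. *)
Definition tensor (a b : 'rV[R]_n) : 'M[R]_n := a^T *m b.

Definition star_shaped (B Omega : set 'rV[R]_n) : Prop :=
  B `<=` Omega /\
  forall x x0 t, Omega x -> B x0 -> 0 <= t <= 1 ->
    Omega ((1 - t) *: x + t *: x0).

Definition elipschitz (f : 'rV[R]_n -> 'rV[R]_n) : Prop :=
  exists L : R, forall x y, enorm (f x - f y) <= L * enorm (x - y).

Definition bilipschitz (f : 'rV[R]_n -> 'rV[R]_n) : Prop :=
  elipschitz f /\
  exists h : 'rV[R]_n -> 'rV[R]_n, [/\ cancel f h, cancel h f & elipschitz h].

(* Null sets of n-dimensional Lebesgue measure: for every e > 0, a countable
   cover by boxes of total volume at most e. *)
Definition box (a b : 'rV[R]_n) : set 'rV[R]_n :=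
  [set x | forall i, a 0 i <= x 0 i <= b 0 i].

Definition lebesgue_null (N : set 'rV[R]_n) : Prop :=
  forall e : R, 0 < e -> exists a b : nat -> 'rV[R]_n,
    [/\ forall k i, a k 0 i <= b k 0 i,
        N `<=` \bigcup_k box (a k) (b k) &
        (\sum_(0 <= k <oo) (\prod_(i < n) (b k 0 i - a k 0 i))%:E <= e%:E)%E].

Definition lebesgue_ae (P : 'rV[R]_n -> Prop) : Prop :=
  lebesgue_null [set x | ~ P x].

Definition expansion_fun (Omega : set 'rV[R]_n) u : R :=
  sup [set t : R | 0 < t /\ Omega (t *: u)].

Definition expansion_map (Omega : set 'rV[R]_n) x : 'rV[R]_n :=
  if x == 0 then 0 else expansion_fun Omega (unit_vec x) *: x.

(* For a unit vector u: s restricted to the unit sphere is differentiable at u,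
   with tangential gradient g. Values of s off the sphere play no role. *)
Definition is_surface_gradient (s : 'rV[R]_n -> R) u g : Prop :=
  dotp g u = 0 /\
  forall e : R, 0 < e -> exists2 d : R, 0 < d &
    forall v, enorm v = 1 -> enorm (v - u) < d ->
      `|s v - s u - dotp g (v - u)| <= e * enorm (v - u).

(* Equal to 0 where there is no surface gradient. *)
Definition surface_gradient (s : 'rV[R]_n -> R) u : 'rV[R]_n :=
  xget 0 [set g | is_surface_gradient s u g].

(* The library's [jacobian] acts on row vectors from the right; its transpose
   is the usual matrix, with entry (i, j) the j-th partial derivative of the
   i-th component. *)
Definition jacobian_matrix (f : 'rV[R]_n -> 'rV[R]_n) x : 'M[R]_n :=
  (jacobian f x)^T.

(* sigma lists the square roots of the eigenvalues of A^T A, counted with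
   multiplicity, in nonincreasing order. *)
Definition is_singular_values (A : 'M[R]_n) (sigma : 'I_n -> R) : Prop :=
  [/\ forall i, 0 <= sigma i,
      forall i j : 'I_n, (i <= j)%N -> sigma j <= sigma i &
      char_poly (A^T *m A) = \prod_(i < n) ('X - (sigma i ^+ 2)%:P)].

End Euclidean.
Arguments eball {R} n t.

(* Main.v *)
Require Import Defs.
From HB Require Import structures.
From mathcomp Require Import all_boot all_order all_algebra.
From mathcomp Require Import all_classical all_reals all_analysis.
From mathcomp Require Import measurable_realfun ring lra.

(** The gauge [p x = enorm x / s (unit_vec x)] of [Omega] is Lipschitz because
    [Omega] is star-shaped with respect to a ball: if [x / t] belongs to [Omega] and
    [w > enorm v / rho], then [(x + v) / (t + w)] is a convex combination of [x / t]
    and of a point of that ball, so [p (x + v) <= p x + enorm v / rho]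
    ([gauge_add]). On the sphere [s] is [1 / p], hence Lipschitz and bounded away
    from 0, and both [S x = s (unit_vec x) *: x] and its inverse
    [y |-> (s (unit_vec y))^-1 *: y] are Lipschitz ([elipschitz_radial]).

    By Rademacher's theorem ([rademacher]) [p] has a gradient at almost every [x].
    By homogeneity [p] then has a gradient at [unit_vec x], so [s] has a surface
    gradient there ([surface_gradient_ex]), and the product rule gives the
    differential of [S] at [x] ([expansion_jacobian]). The singular values and the
    determinant are those of [s%:M + tensor u g], a rank-one perturbation of a
    scalar matrix with [g] orthogonal to the unit vector [u]; Sylvester's
    determinant identity computes them ([tensor_singular_values],
    [det_scalar_tensor]).

    The proof of Rademacher's theorem has three ingredients. On the line, a
    Lipschitz function is almost everywhere differentiable, being up to a linear
    term an indefinite integral ([lipschitz_ae_slope]). To pass from lines to null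
    sets of the space, a countable intersection of open sets whose slices parallel
    to one axis are null is shown to be null ([Gdelta_null]): an open set is covered
    by dyadic cubes whose total volume is at most the iterated integral of its
    indicator, and these integrals tend to 0 by dominated convergence. Finally,
    partial derivatives assemble into a gradient one coordinate at a time
    ([ball_linear_step]). Let [A] be the set where the linear approximation with
    given data holds both along the first coordinates and along the next axis. At
    almost every point [x] of [A] the distance to [A] is differentiable along that
    axis, and its derivative is 0 since the distance is minimal on [A]; thus [A] has
    points very close to [x + t e_i], and the approximation along the first
    coordinates may be used there instead of at [x + t e_i] itself. *)

Set Implicit Arguments.
Unset Strict Implicit.
Unset Printing Implicit Defensive.

Import Order.TTheory GRing.Theory Num.Theory.
Import numFieldNormedType.Exports.

Local Open Scope classical_set_scope.
Local Open Scope ring_scope.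

(** * Norms and neighborhoods *)

Lemma nbhs_distP (R : realType) (V : normedModType R) (x : V) (A : set V) :
  nbhs x A <-> exists2 e : R, 0 < e & forall y, `|x - y| < e -> A y.
Proof.
rewrite -nbhs_ballE /nbhs_ball_ /filter_from; split=> -[e e0 H]; exists e => //.
  by move=> y xy; apply: H; rewrite -ball_normE.
by move=> y; rewrite -ball_normE; exact: H.
Qed.

Section EuclideanNorm.
Variables (R : realType) (n : nat).
Implicit Types (x y z u v g : 'rV[R]_n) (t c : R).

Lemma dotpC x y : dotp x y = dotp y x.
Proof. by apply: eq_bigr => i _; rewrite mulrC. Qed.

Lemma dotpDl x y z : dotp (x + y) z = dotp x z + dotp y z.
Proof. by rewrite -big_split; apply: eq_bigr => i _; rewrite mxE mulrDl. Qed.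

Lemma dotpZl c x y : dotp (c *: x) y = c * dotp x y.
Proof. by rewrite mulr_sumr; apply: eq_bigr => i _; rewrite mxE mulrA. Qed.

Lemma dotpNl x y : dotp (- x) y = - dotp x y.
Proof. by rewrite -scaleN1r dotpZl mulN1r. Qed.

Lemma dotpBl x y z : dotp (x - y) z = dotp x z - dotp y z.
Proof. by rewrite dotpDl dotpNl. Qed.

Lemma dotpDr x y z : dotp x (y + z) = dotp x y + dotp x z.
Proof. by rewrite dotpC dotpDl !(dotpC x). Qed.

Lemma dotpZr c x y : dotp x (c *: y) = c * dotp x y.
Proof. by rewrite dotpC dotpZl dotpC. Qed.

Lemma dotpNr x y : dotp x (- y) = - dotp x y.
Proof. by rewrite dotpC dotpNl dotpC. Qed.

Lemma dotpBr x y z : dotp x (y - z) = dotp x y - dotp x z.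
Proof. by rewrite dotpDr dotpNr. Qed.

Lemma dotp0l x : dotp 0 x = 0.
Proof. by rewrite /dotp big1// => i _; rewrite mxE mul0r. Qed.

Lemma dotp_ge0 x : 0 <= dotp x x.
Proof. by apply: sumr_ge0 => i _; rewrite -expr2 sqr_ge0. Qed.

Lemma enorm_ge0 x : 0 <= enorm x.
Proof. exact: sqrtr_ge0. Qed.

Lemma sqr_enorm x : enorm x ^+ 2 = dotp x x.
Proof. by rewrite sqr_sqrtr// dotp_ge0. Qed.

Lemma enormZ c x : enorm (c *: x) = `|c| * enorm x.
Proof.
by rewrite /enorm dotpZl dotpZr mulrA -expr2 sqrtrM ?sqr_ge0// sqrtr_sqr.
Qed.

Lemma enormN x : enorm (- x) = enorm x.
Proof. by rewrite -scaleN1r enormZ normrN1 mul1r. Qed.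

Lemma enorm0 : enorm (0 : 'rV[R]_n) = 0.
Proof. by rewrite /enorm dotp0l sqrtr0. Qed.

Lemma coord_le_norm x i : `|x 0 i| <= `|x|.
Proof.
by rewrite [leRHS]mx_normrE; apply/bigmax_geP; right; exists (0, i).
Qed.

Lemma norm_le_coord x c : 0 <= c -> (forall i, `|x 0 i| <= c) -> `|x| <= c.
Proof.
move=> c0 xc; rewrite [leLHS]mx_normrE; apply/bigmax_leP; split=> //.
by case=> i j _ /=; rewrite (ord1 i).
Qed.

Lemma norm_le_enorm x : `|x| <= enorm x.
Proof.
apply: norm_le_coord => [|i]; first exact: enorm_ge0.
rewrite -[leLHS]sqrtr_sqr ler_sqrt ?dotp_ge0//.
rewrite expr2 /dotp (bigD1 i)//= lerDl.
by apply: sumr_ge0 => j _; rewrite -expr2 sqr_ge0.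
Qed.

Lemma dotp_le_norm x y : `|dotp x y| <= n%:R * (`|x| * `|y|).
Proof.
apply: le_trans (ler_norm_sum _ _ _) _.
apply: (@le_trans _ _ (\sum_(i < n) `|x| * `|y|)).
  by apply: ler_sum => i _; rewrite normrM ler_pM// coord_le_norm.
by rewrite sumr_const card_ord mulr_natl.
Qed.

Lemma enorm_le_norm x : enorm x <= n%:R * `|x|.
Proof.
have nx : 0 <= n%:R * `|x| :> R by rewrite mulr_ge0.
rewrite -(ler_pXn2r (n:=2)) ?nnegrE ?enorm_ge0// sqr_enorm.
apply: le_trans (ler_norm _) _; apply: le_trans (dotp_le_norm _ _) _.
rewrite exprMn -expr2 ler_wpM2r ?sqr_ge0// expr2 -natrM ler_nat.
by case: (n) => // m; rewrite leq_pmulr.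
Qed.

Lemma enorm_eq0 x : (enorm x == 0) = (x == 0).
Proof.
apply/idP/idP => [/eqP x0|/eqP->]; last by rewrite enorm0.
by rewrite -normr_le0 -x0 norm_le_enorm.
Qed.

Lemma enorm_gt0 x : (0 < enorm x) = (x != 0).
Proof. by rewrite lt_def enorm_eq0 enorm_ge0 andbT. Qed.

Lemma cauchy_schwarz x y : `|dotp x y| <= enorm x * enorm y.
Proof.
have [->|x0] := eqVneq x 0; first by rewrite dotp0l enorm0 normr0 mul0r.
rewrite -(ler_pXn2r (n:=2)) ?nnegrE ?mulr_ge0 ?enorm_ge0//.
rewrite exprMn !sqr_enorm real_normK ?num_real//.
have x2 : 0 < dotp x x by rewrite -sqr_enorm exprn_gt0// enorm_gt0.
have := dotp_ge0 (dotp x x *: y - dotp x y *: x).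
rewrite dotpBl !dotpBr !dotpZl !dotpZr (dotpC y x) => h.
have : 0 <= dotp x x * (dotp x x * dotp y y - dotp x y ^+ 2) by lra.
by rewrite pmulr_rge0// subr_ge0.
Qed.

Lemma enormD x y : enorm (x + y) <= enorm x + enorm y.
Proof.
rewrite -(ler_pXn2r (n:=2)) ?nnegrE ?addr_ge0 ?enorm_ge0//.
rewrite sqrrD !sqr_enorm dotpDl !dotpDr (dotpC y x).
have := le_trans (ler_norm _) (cauchy_schwarz x y); lra.
Qed.

Lemma enorm_distC x y : enorm (x - y) = enorm (y - x).
Proof. by rewrite -enormN opprB. Qed.

Lemma enorm_dist_dist x y : `|enorm x - enorm y| <= enorm (x - y).
Proof.
rewrite ler_norml; apply/andP; split.
  by have := enormD (y - x) x; rewrite subrK (enorm_distC y x); lra.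
by have := enormD (x - y) y; rewrite subrK; lra.
Qed.

Lemma unit_vecK x : enorm x *: unit_vec x = x.
Proof.
have [->|x0] := eqVneq x 0; first by rewrite enorm0 scale0r.
by rewrite scalerA divff ?enorm_eq0// scale1r.
Qed.

Lemma enorm_unit_vec x : x != 0 -> enorm (unit_vec x) = 1.
Proof.
move=> x0; rewrite enormZ normfV ger0_norm ?enorm_ge0//.
by rewrite mulVf// enorm_eq0.
Qed.

Lemma unit_vecZ c x : 0 < c -> unit_vec (c *: x) = unit_vec x.
Proof.
move=> c0; rewrite /unit_vec enormZ gtr0_norm// scalerA invfM mulrC mulrA.
by rewrite mulfV ?mul1r// gt_eqF.
Qed.

Lemma unit_vec_id u : enorm u = 1 -> unit_vec u = u.
Proof. by move=> u1; rewrite /unit_vec u1 invr1 scale1r. Qed.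

(** Both [enorm y *: unit_vec x] and [y] are within [enorm (x - y)] of [x]. *)
Lemma unit_vec_dist x y : x != 0 ->
  enorm (unit_vec x - unit_vec y) * enorm y <= 2 * enorm (x - y).
Proof.
move=> x0.
have -> : enorm (unit_vec x - unit_vec y) * enorm y =
    enorm ((enorm y - enorm x) *: unit_vec x + (x - y)).
  rewrite mulrC -{1}(ger0_norm (enorm_ge0 y)) -enormZ; congr enorm.
  by rewrite scalerBr scalerBl !unit_vecK addrA subrK.
apply: le_trans (enormD _ _) _; rewrite enormZ enorm_unit_vec// mulr1.
have := enorm_dist_dist y x; rewrite (enorm_distC y x); lra.
Qed.

End EuclideanNorm.

(** * Null sets *)

Section NullSets.
Variables (R : realType) (n : nat).
Implicit Types (N : set 'rV[R]_n).

Lemma lebesgue_nullS N N' : N `<=` N' -> lebesgue_null N' -> lebesgue_null N.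
Proof.
move=> NN' N0 e e0; have [a [b [ab Nab sab]]] := N0 e e0.
by exists a, b; split=> //; exact: subset_trans Nab.
Qed.

(** The covers of the [N k] are laid out as one sequence through a bijection of
    [nat] with [nat * nat], the k-th one being given the share e / 2 ^ (k + 1). *)
Lemma lebesgue_null_bigcup (N : nat -> set 'rV[R]_n) :
  (forall k, lebesgue_null (N k)) -> lebesgue_null (\bigcup_k N k).
Proof.
move=> N0 e e0.
have ek k : 0 < e / (2 ^ k.+1)%:R by rewrite divr_gt0.
have /choice[ab Hab] k : exists ab : (nat -> 'rV[R]_n) * (nat -> 'rV[R]_n),
    [/\ forall l i, ab.1 l 0 i <= ab.2 l 0 i,
        N k `<=` \bigcup_l box (ab.1 l) (ab.2 l) &
        (\sum_(0 <= l <oo) (\prod_(i < n) (ab.2 l 0 i - ab.1 l 0 i))%:E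
          <= (e / (2 ^ k.+1)%:R)%:E)%E].
  by have [a [b ?]] := N0 k _ (ek k); exists (a, b).
have /card_esym/ppcard_eqP[f] := card_nat2.
exists (fun m => (ab (f m).1).1 (f m).2), (fun m => (ab (f m).1).2 (f m).2).
pose v (p : nat * nat) : \bar R :=
  (\prod_(i < n) ((ab p.1).2 p.2 0 i - (ab p.1).1 p.2 0 i))%:E.
have v0 p : (0 <= v p)%E.
  rewrite lee_fin; apply: prodr_ge0 => i _; rewrite subr_ge0.
  by have [] := Hab p.1.
split=> [m i||]; first by have [] := Hab (f m).1.
  move=> x [k _ Nx]; have [_ /(_ _ Nx)[l _ xl] _] := Hab k.
  by exists (f^-1%FUN (k, l)) => //; rewrite invK ?inE.
rewrite [leLHS](_ : _ = \sum_(0 <= m <oo) v (f m))%E//.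
have -> : (\sum_(0 <= m <oo) v (f m) = \esum_(p in setT) v p)%E.
  by rewrite -(esum_pred_image v _ xpredT) ?[fun=> _]set_true// image_eq.
have -> : (\esum_(p in setT) v p = \sum_(0 <= k <oo) \sum_(0 <= l <oo) v (k, l))%E.
  rewrite [LHS](_ : _ = \esum_(p in [set: nat] `*`` (fun=> [set: nat])) v p)%E;
    last by congr esum; apply/seteqP; split.
  have := @esum_esum R nat nat [set: nat] (fun=> [set: nat]) (fun k l => v (k, l)).
  move=> <- //.
  rewrite nneseries_esumT => [|k]; last by apply: nneseries_ge0 => *; exact: v0.
  by apply: eq_esum => k _; rewrite nneseries_esumT// => l; exact: v0.
apply: (@le_trans _ _ (\sum_(0 <= k <oo) (e / (2 ^ k.+1)%:R)%:E)%E).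
  apply: lee_nneseries => k _ *; first by apply: nneseries_ge0 => *; exact: v0.
  by have [] := Hab k.
have := @epsilon_trick R (fun=> 0%E) e xpredT (fun=> lexx _) (ltW e0).
rewrite [X in (_ <= X + _)%E]eseries0// add0e; apply: le_trans.
by apply: lee_nneseries => k *; rewrite ?add0e// lee_fin ltW.
Qed.

Lemma lebesgue_null_bigcup_count (T : countType) (N : T -> set 'rV[R]_n) :
  lebesgue_null (set0 : set 'rV[R]_n) ->
  (forall c, lebesgue_null (N c)) -> lebesgue_null (\bigcup_c N c).
Proof.
move=> null0 N0.
pose N' k := if @pickle_inv T k is Some c then N c else set0.
apply: (@lebesgue_nullS _ (\bigcup_k N' k)).
  by move=> x [c _ Nx]; exists (pickle c) => //; rewrite /N' pickleK_inv.
by apply: lebesgue_null_bigcup => k; rewrite /N'; case: pickle_inv.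
Qed.

Lemma lebesgue_nullU N N' :
  lebesgue_null N -> lebesgue_null N' -> lebesgue_null (N `|` N').
Proof.
move=> N0 N'0.
apply: (@lebesgue_nullS _ (\bigcup_k if k is 0%N then N else N')).
  by move=> x [?|?]; [exists 0%N|exists 1%N].
by apply: lebesgue_null_bigcup; case.
Qed.

Lemma lebesgue_null1 (x : 'rV[R]_n) : (0 < n)%N -> lebesgue_null [set x].
Proof.
move=> n0 e e0; exists (fun=> x), (fun=> x); split=> // [_ ->|].
  by exists 0%N => // i; rewrite lexx.
rewrite eseries0 ?lee_fin ?ltW// => k _ _.
case: n n0 x => // m _ x.
by rewrite big_ord_recl subrr mul0r.
Qed.

Lemma lebesgue_null0 : (0 < n)%N -> lebesgue_null (set0 : set 'rV[R]_n).
Proof. by move=> n0; apply: lebesgue_nullS (lebesgue_null1 0 n0). Qed.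

End NullSets.

(** * Iterated integrals of lower semicontinuous functions *)

Section ExtendedReals.
Variable R : realType.

Lemma lt_addeP (u v : \bar R) (a : R) : (0 <= u)%E -> (0 <= v)%E ->
  (a%:E < u + v)%E -> exists b c, [/\ (b%:E < u)%E, (c%:E < v)%E & a <= b + c].
Proof.
case: u v => [u| |] [v| |]//=; rewrite ?lee_fin ?lte_fin => u0 v0 auv.
- by exists (u - (u + v - a) / 2), (v - (u + v - a) / 2); split; rewrite ?lte_fin; lra.
- by clear auv v0; exists (u - 1), (a + 1 - u); split; rewrite ?ltry ?lte_fin; lra.
- by clear auv u0; exists (a + 1 - v), (v - 1); split; rewrite ?ltry ?lte_fin; lra.
- by exists a, 0; rewrite addr0 !ltry.
Qed.

Lemma le_limn_einf (u : nat -> \bar R) (l : \bar R) :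
  (forall a, (a%:E < l)%E -> \forall k \near \oo, (a%:E < u k)%E) ->
  (0 <= l)%E -> (l <= limn_einf u)%E.
Proof.
move=> lu l0.
have al a : (a%:E < l)%E -> (a%:E <= limn_einf u)%E.
  move=> /lu[N _ Nu]; rewrite limn_einf_lim (cvg_lim _ (@cvg_einfs_sup _ u))//.
  apply: le_trans (ereal_sup_ubound _); last by exists N.
  apply: le_ereal_inf_tmp => _ [k /= Nk <-]; exact/ltW/Nu.
case: l l0 {lu} al => [l| |]// _ al.
  by apply/lee_subgt0Pr => e e0; rewrite -EFinB al// lte_fin ltrBlDr ltrDl.
by rewrite leye_eq; apply/eqP/eqyP => a a0; rewrite al// ltry.
Qed.

Lemma limn_einf_le (u : nat -> \bar R) (l : \bar R) :
  (forall k, u k <= l)%E -> (limn_einf u <= l)%E.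
Proof.
move=> ul; rewrite limn_einf_lim (cvg_lim _ (@cvg_einfs_sup _ u))//.
apply: ge_ereal_sup => _ [k _ <-]; apply: le_trans (ul k).
by apply: ereal_inf_lbound; exists k => /=.
Qed.

End ExtendedReals.

Section Slices.
Variables (R : realType) (n : nat).
Implicit Types (x y : 'rV[R]_n) (i : 'I_n) (g : 'rV[R]_n -> \bar R).
Local Notation mu := (@lebesgue_measure R).

Definition upd x i (t : R) : 'rV[R]_n := \row_j (if j == i then t else x 0 j).

Lemma upd_dist x y i t t' :
  `|upd x i t - upd y i t'| <= Num.max `|x - y| `|t - t'|.
Proof.
apply: norm_le_coord => [|j]; first by rewrite le_max normr_ge0.
rewrite !mxE; case: ifP => _; first by rewrite le_max lexx orbT.
by rewrite le_max (le_trans _ (coord_le_norm (x - y) j))// !mxE.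
Qed.

(** This class contains the indicators of open sets and is stable under sums and
    under integration along a coordinate, so that iterated integrals make sense
    with no other measurable sets than those of the line. *)
Definition lsc_ge0 g := (forall x, 0 <= g x)%E /\ lower_semicontinuous g.

Lemma lscP g : lower_semicontinuous g <-> forall x a, (a%:E < g x)%E ->
  exists2 e : R, 0 < e & forall y, `|x - y| < e -> (a%:E < g y)%E.
Proof.
split=> H x a /H.
  by case=> V /nbhs_distP[e e0 xV] Vg; exists e => // y /xV /Vg.
by case=> e e0 xe; exists [set y | a%:E < g y]%E => //; apply/nbhs_distP; exists e.
Qed.

Lemma lsc_slice g x i : lower_semicontinuous g ->
  lower_semicontinuous (fun t => g (upd x i t)).
Proof.
move=> /lscP gl t a /gl[e e0 He].
exists [set t' | a%:E < g (upd x i t')]%E => //; apply/nbhs_distP; exists e => //.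
move=> t' tt'; apply: He; apply: le_lt_trans (upd_dist _ _ _ _ _) _.
by rewrite subrr normr0 gt_max e0.
Qed.

Lemma measurable_slice g x i (D : set R) : lower_semicontinuous g ->
  measurable_fun D (fun t => g (upd x i t)).
Proof.
move=> gl; apply: measurable_funTS.
by apply: lower_semicontinuous_measurable; exact: lsc_slice.
Qed.

Lemma lsc_ge0_indic (U : set 'rV[R]_n) : open U ->
  lsc_ge0 (fun x => (\1_U x)%:E).
Proof.
move=> oU; split=> [x|]; first by rewrite lee_fin indicE.
apply/lower_semicontinuousP => a.
have [a0|a0] := ltP a 0.
  rewrite (_ : [set _ | _] = setT); first exact: openT.
  by apply/seteqP; split=> // x _ /=; rewrite lte_fin (lt_le_trans a0)// indicE.
have [a1|a1] := ltP a 1.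
  rewrite (_ : [set _ | _] = U) //; apply/seteqP; split=> x /=.
    rewrite lte_fin indicE; case: (boolP (x \in U)) => [/set_mem//|_].
    by rewrite ltNge a0.
  by move=> Ux; rewrite indicE mem_set.
rewrite (_ : [set _ | _] = set0); first exact: open0.
apply/seteqP; split=> // x /=; rewrite lte_fin indicE ltNge.
by rewrite (le_trans _ a1)// lern1 leq_b1.
Qed.

Lemma lsc_ge0D f g : lsc_ge0 f -> lsc_ge0 g -> lsc_ge0 (f \+ g)%E.
Proof.
move=> [f0 /lscP fl] [g0 /lscP gl]; split=> [x|]; first exact: adde_ge0.
apply/lscP => x a /lt_addeP[//|//|b [c [/fl[e e0 He] /gl[d d0 Hd] abc]]].
exists (Num.min e d) => [|y]; first by rewrite lt_min e0.
rewrite lt_min => /andP[xe xd]; rewrite (@le_lt_trans _ _ (b%:E + c%:E)%E)//.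
by apply: lteD; [exact: He|exact: Hd].
Qed.

Lemma lsc_ge0_sum (I : Type) (s : seq I) (f : I -> 'rV[R]_n -> \bar R) :
  (forall k, lsc_ge0 (f k)) -> lsc_ge0 (fun x => \sum_(k <- s) f k x)%E.
Proof.
move=> fl; elim: s => [|k s IH].
  under eq_fun do rewrite big_nil.
  split=> // x a a0; exists setT => //; exact: filterT.
by under eq_fun do rewrite big_cons; exact: lsc_ge0D.
Qed.

Variable M : R.

(** The result, constant in the [i]-th coordinate, is kept as a function on the
    whole space so that integrations in several coordinates compose. *)
Definition slice_int i g x : \bar R :=
  (\int[mu]_(t in `[(- M)%R, M]) g (upd x i t))%E.

Lemma slice_int_ge0 i g x : (forall x, 0 <= g x)%E -> (0 <= slice_int i g x)%E.
Proof. by move=> g0; apply: integral_ge0 => t _. Qed.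

(** By Fatou's lemma along a sequence that converges to [x]. *)
Lemma lsc_slice_int i g : lsc_ge0 g -> lsc_ge0 (slice_int i g).
Proof.
case=> g0 gl; split=> [x|]; first exact: slice_int_ge0.
apply/lscP => x a ax; apply: contrapT => /forall2NP H.
have /choice[y Hy] (k : nat) : exists y, `|x - y| < k.+1%:R^-1 /\
    (slice_int i g y <= a%:E)%E.
  have [|] := H k.+1%:R^-1; first by rewrite invr_gt0.
  by move=> /existsNP[y /not_implyP[xy /negP]]; rewrite -leNgt => ?; exists y.
suff : (slice_int i g x <= a%:E)%E by rewrite leNgt ax.
apply: (@le_trans _ _ (\int[mu]_(t in `[(- M)%R, M])
    limn_einf (fun k => g (upd (y k) i t)))%E).
  apply: ge0_le_integral => //.
  - exact: measurable_slice.
  - rewrite /limn_einf; apply: measurableT_comp => //.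
    apply: measurable_fun_limn_esup => k; apply: measurableT_comp => //.
    exact: measurable_slice.
  move=> t _; apply: le_limn_einf => // b /((lscP _).1 gl)[e e0 He].
  near=> k; apply: He; apply: le_lt_trans (upd_dist _ _ _ _ _) _.
  rewrite subrr normr0 gt_max e0 andbT; apply: lt_trans (Hy k).1 _.
  near: k; exact: near_infty_natSinv_lt (PosNum e0).
apply: le_trans (fatou _ _ _ _) _ => //.
- by move=> k; exact: measurable_slice.
- by apply: limn_einf_le => k; exact: (Hy k).2.
Unshelve. all: by end_near. Qed.

Lemma le_slice_int i g h x : lsc_ge0 g -> lsc_ge0 h ->
  (forall y, g y <= h y)%E -> (slice_int i g x <= slice_int i h x)%E.
Proof.
move=> [g0 gl] [h0 hl] gh; apply: ge0_le_integral => //; exact: measurable_slice.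
Qed.

Lemma slice_int_sum (I : Type) (s : seq I) i (f : I -> 'rV[R]_n -> \bar R) x :
  (forall k, lsc_ge0 (f k)) ->
  slice_int i (fun y => \sum_(k <- s) f k y)%E x = (\sum_(k <- s) slice_int i (f k) x)%E.
Proof.
move=> fl; rewrite /slice_int ge0_integral_sum// => k.
  by apply: measurable_slice; exact: (fl k).2.
by move=> *; exact: (fl k).1.
Qed.

Hypothesis M0 : 0 < M.

Lemma slice_int_cvg0 i (g : nat -> 'rV[R]_n -> \bar R) (C : R) x :
  (forall m, lsc_ge0 (g m)) -> (forall m y, g m y <= C%:E)%E ->
  {ae mu, forall t, g m (upd x i t) @[m --> \oo] --> (0 : \bar R)} ->
  slice_int i (g m) x @[m --> \oo] --> (0 : \bar R).
Proof.
move=> gl gC g0.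
have [] := @dominated_convergence _ _ _ mu `[(- M)%R, M]%classic _
  (fun m t => g m (upd x i t)) (cst 0%E) (cst C%:E) => //.
- by move=> m; apply: measurable_slice; exact: (gl m).2.
- by apply: (@filterS _ _ (ae_filter_ringOfSetsType mu) _ _ _ g0) => t gt _.
- apply/integrableP; split=> //=.
  by rewrite integral_cst//= lebesgue_measure_itv/=; case: ifPn => _; rewrite ltry.
- by apply/aeW => t m _ /=; rewrite gee0_abs//; exact: (gl m).1.
by move=> _ _; rewrite integral0.
Qed.

Lemma slice_int_le i g (C : R) x : lsc_ge0 g -> (forall y, g y <= C%:E)%E ->
  (slice_int i g x <= (C * (2 * M))%:E)%E.
Proof.
move=> [g0 gl] gC; apply: (@le_trans _ _ (\int[mu]_(t in `[(- M)%R, M]) cst C%:E t)%E).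
  by apply: ge0_le_integral => //; exact: measurable_slice.
rewrite integral_cst//= lebesgue_measure_itv/= lte_fin ifT; last first.
  by rewrite ltrNl (lt_trans _ M0)// oppr_lt0.
by rewrite -EFinB -EFinM opprK -mulr2n mulr_natl.
Qed.

End Slices.

(** * Dyadic decomposition of open sets *)

Section Dyadic.
Variables (R : realType) (n : nat).
Implicit Types (x y a b : 'rV[R]_n) (W : set 'rV[R]_n) (z : {ffun 'I_n -> int}).

Definition obox a b : set 'rV[R]_n := [set x | forall i, a 0 i < x 0 i < b 0 i].

Definition dyadic_index (l : nat) x : {ffun 'I_n -> int} :=
  [ffun i => Num.floor (2 ^+ l * x 0 i)].

Definition dyadic_lo (l : nat) z : 'rV[R]_n := \row_i ((z i)%:~R / 2 ^+ l).
Definition dyadic_hi (l : nat) z : 'rV[R]_n := \row_i ((z i + 1)%:~R / 2 ^+ l).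
Definition dyadic_box l z := box (dyadic_lo l z) (dyadic_hi l z).

Let pow2_gt0 l : 0 < 2 ^+ l :> R. Proof. exact: exprn_gt0. Qed.

Lemma dyadic_lo_le_hi l z i : dyadic_lo l z 0 i <= dyadic_hi l z 0 i.
Proof. by rewrite !mxE ler_pM2r ?invr_gt0// ler_int lerDl. Qed.

Lemma mem_dyadic_box l x : dyadic_box l (dyadic_index l x) x.
Proof.
move=> i; rewrite !mxE ffunE ler_pdivrMr// ler_pdivlMr// mulrC floor_le /=.
exact/ltW/floorD1_gt.
Qed.

Lemma obox_dyadic_index l z x : obox (dyadic_lo l z) (dyadic_hi l z) x ->
  dyadic_index l x = z.
Proof.
move=> xz; apply/ffunP => i; rewrite ffunE; apply: floor_def.
have := xz i; rewrite !mxE ltr_pdivrMr// ltr_pdivlMr// mulrC.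
by case/andP=> /ltW -> ->.
Qed.

(** The integer [m] is at most [floor (2 ^+ l0 * t)] if and only if the integer
    [2 ^+ (l - l0) * m] is at most [floor (2 ^+ l * t)]. *)
Lemma dyadic_index_coarsen l0 l x y : (l0 <= l)%N ->
  dyadic_index l x = dyadic_index l y -> dyadic_index l0 x = dyadic_index l0 y.
Proof.
move=> l0l; wlog suff H : x y / dyadic_index l x = dyadic_index l y ->
    forall i, (dyadic_index l0 x i <= dyadic_index l0 y i)%R.
  by move=> xy; apply/ffunP => i; apply/le_anti; rewrite !H.
move=> /ffunP xy i; have := xy i; rewrite !ffunE => xyi.
have pow2E : 2 ^+ l = 2 ^+ (l - l0) * 2 ^+ l0 :> R by rewrite -exprD subnK.
rewrite floor_ge_int -(ler_pM2l (pow2_gt0 (l - l0))) mulrA -pow2E.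
rewrite (_ : 2 ^+ (l - l0) = (2 ^+ (l - l0))%:~R :> R); last by rewrite rmorphXn.
rewrite -intrM -floor_ge_int -xyi floor_ge_int intrM rmorphXn /=.
by rewrite pow2E -mulrA ler_pM2l// floor_le.
Qed.

(** Maximality is expressed through the points of the cube rather than through
    its ancestors, which avoids computing the indices of the latter. *)
Definition maximal_dyadic W l z := dyadic_box l z `<=` W /\
  forall l0 x, (l0 < l)%N -> dyadic_index l x = z ->
    ~ dyadic_box l0 (dyadic_index l0 x) `<=` W.

Lemma open_dyadic W x : open W -> W x ->
  exists l, dyadic_box l (dyadic_index l x) `<=` W.
Proof.
move=> oW Wx; have /nbhs_distP[e e0 We] : nbhs x W by exact: open_nbhs_nbhs.
have [l _ /(_ l (leqnn _)) le] := near_infty_natSinv_expn_lt (PosNum e0).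
exists l => y yx; apply: We; apply: le_lt_trans le.
apply: norm_le_coord => [|i]; first by rewrite divr_ge0// ltW.
have := yx i; have := mem_dyadic_box l x i; rewrite !mxE intrD mulrDl mulr1z /=.
move: (_%:~R / _) (1 / _) => u v /andP[? ?] /andP[? ?].
by rewrite ler_norml; apply/andP; split; lra.
Qed.

(** These are the maximal dyadic cubes contained in [W], enumerated through
    [pickle]; degenerate boxes pad the enumeration. *)
Lemma open_dyadic_decomposition W : (0 < n)%N -> open W ->
  exists a b : nat -> 'rV[R]_n,
  [/\ forall k i, a k 0 i <= b k 0 i,
      W `<=` \bigcup_k box (a k) (b k),
      forall k, box (a k) (b k) `<=` W \/ a k = 0 /\ b k = 0 &
      trivIset setT (fun k => obox (a k) (b k))].
Proof.
move=> n0 oW.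
(* [pickle_inv] is injective where it is defined, unlike [unpickle], so that no
   cube is listed twice. *)
pose c k : option (nat * {ffun 'I_n -> int}) :=
  if @pickle_inv _ k is Some p then
    if `[< maximal_dyadic W p.1 p.2 >] then Some p else None
  else None.
pose a k := if c k is Some p then dyadic_lo p.1 p.2 else 0.
pose b k := if c k is Some p then dyadic_hi p.1 p.2 else 0.
have cP k p : c k = Some p -> maximal_dyadic W p.1 p.2 /\ pickle p = k.
  rewrite /c; have := @pickle_invK (nat * {ffun 'I_n -> int})%type k.
  by case: pickle_inv => //= q qk; case: asboolP => // mq [<-].
have oboxP k x : obox (a k) (b k) x ->
    exists p, c k = Some p /\ dyadic_index p.1 x = p.2.
  rewrite /a /b; case: (c k) => [p /obox_dyadic_index ?|]; first by exists p.
  by move=> /(_ (Ordinal n0)); rewrite mxE => /andP[/lt_trans h /h]; rewrite ltxx.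
exists a, b; split.
- move=> k i; rewrite /a /b; case: (c k) => // p; exact: dyadic_lo_le_hi.
- move=> x Wx.
  have exl : exists l, `[< dyadic_box l (dyadic_index l x) `<=` W >].
    by have [l ?] := open_dyadic oW Wx; exists l; exact/asboolP.
  case: (ex_minnP exl) => l /asboolP lW lmin.
  exists (pickle (l, dyadic_index l x)) => //; rewrite /a /b /c pickleK_inv /=.
  case: asboolP => [_|[]]; first exact: mem_dyadic_box.
  split=> // l0 y l0l yx; rewrite (dyadic_index_coarsen (ltnW l0l) yx) => /asboolP.
  by move/lmin; rewrite leqNgt l0l.
- move=> k; rewrite /a /b; case ck: (c k) => [p|]; last by right.
  by left; have [[]] := cP _ _ ck.
- apply/trivIsetP => k k' _ _; apply: contra_neqP => /eqP/set0P[x [xk xk']].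
  have [p [ckp xp]] := oboxP _ _ xk; have [p' [ckp' xp']] := oboxP _ _ xk'.
  have [[pW pmax] <-] := cP _ _ ckp; have [[pW' pmax'] <-] := cP _ _ ckp'.
  case: p p' {ckp ckp'} xp xp' pW pmax pW' pmax' => [l z] [l' z'] /= <- <- pW pmax pW' pmax'.
  have [ll'|l'l|->//] := ltngtP l l'.
    by have [] := pmax' l x ll' erefl.
  by have [] := pmax l' x l'l erefl.
Qed.

End Dyadic.

(** * Iterated integrals and volumes of covers *)

Section BoxIntegral.
Variables (R : realType) (n : nat) (M : R).
Hypothesis M0 : 0 < M.
Implicit Types (x y a b : 'rV[R]_n) (i : 'I_n) (s : seq 'I_n)
  (g : 'rV[R]_n -> \bar R).
Local Notation mu := (@lebesgue_measure R).

Definition iter_int s g : 'rV[R]_n -> \bar R := foldr (@slice_int R n M) g s.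

Lemma lsc_iter_int s g : lsc_ge0 g -> lsc_ge0 (iter_int s g).
Proof. by move=> gl; elim: s => //= i s; exact: lsc_slice_int. Qed.

Lemma le_iter_int s g h : lsc_ge0 g -> lsc_ge0 h ->
  (forall y, g y <= h y)%E -> forall x, (iter_int s g x <= iter_int s h x)%E.
Proof.
move=> gl hl gh; elim: s => //= i s IH x.
by apply: le_slice_int => //; exact: lsc_iter_int.
Qed.

Lemma iter_int_sum (I : Type) (r : seq I) s (f : I -> 'rV[R]_n -> \bar R) :
  (forall k, lsc_ge0 (f k)) -> forall x,
  iter_int s (fun y => \sum_(k <- r) f k y)%E x =
  (\sum_(k <- r) iter_int s (f k) x)%E.
Proof.
move=> fl; elim: s => //= i s IH x.
rewrite [X in slice_int _ _ X](funext IH) slice_int_sum// => k.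
exact: lsc_iter_int.
Qed.

Lemma iter_int_cvg0 s i (g : nat -> 'rV[R]_n -> \bar R) :
  (forall m, lsc_ge0 (g m)) -> (forall m y, g m y <= 1)%E ->
  (forall x, {ae mu, forall t, g m (upd x i t) @[m --> \oo] --> (0 : \bar R)}) ->
  forall x, iter_int (rcons s i) (g m) x @[m --> \oo] --> (0 : \bar R).
Proof.
move=> gl g1 g0.
have rconsE m : iter_int (rcons s i) (g m) = iter_int s (slice_int M i (g m)).
  by rewrite /iter_int foldr_rcons.
suff : (forall m, lsc_ge0 (iter_int s (slice_int M i (g m)))) /\
    (exists C : R, forall m y, iter_int s (slice_int M i (g m)) y <= C%:E)%E /\
    forall x, iter_int s (slice_int M i (g m)) x @[m --> \oo] --> (0 : \bar R).
  by case=> _ [_ +] x; move=> /(_ x); under eq_cvg do rewrite -rconsE.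
elim: s {rconsE} => [|j s [IHl [[C IHC] IH]]] /=.
  split=> [m|]; first exact: lsc_slice_int.
  split; first by exists (1 * (2 * M)) => m y; exact: slice_int_le.
  by move=> x; apply: slice_int_cvg0 => //; exact: g1.
split=> [m|]; first exact: lsc_slice_int.
split; first by exists (C * (2 * M)) => m y; exact: slice_int_le.
move=> x; apply: slice_int_cvg0 => //; exact/aeW.
Qed.

(** Integrating the indicator of a box along some coordinates leaves a multiple of
    the indicator of the cylinder constrained by the remaining ones. *)
Definition pbox (P : pred 'I_n) a b : set 'rV[R]_n :=
  [set x | forall i, P i -> a 0 i < x 0 i < b 0 i].

Lemma pbox_upd (P : pred 'I_n) a b x i t : P i ->
  \1_(pbox P a b) (upd x i t) =
  \1_(pbox [predD1 P & i] a b) x * \1_(`]a 0 i, b 0 i[) t :> R.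
Proof.
move=> Pi; rewrite !indicE -natrM mulnb; congr (nat_of_bool _)%:R.
apply/idP/andP => [/set_mem xP|[/set_mem xP /set_mem tab]].
  split; apply/mem_set; last by have := xP i Pi; rewrite mxE eqxx /= in_itv.
  by move=> j /andP[/negbTE ji Pj]; have := xP j Pj; rewrite mxE ji.
apply/mem_set => j Pj; rewrite mxE; case: ifPn => [/eqP->|ji].
  by move: tab; rewrite /= in_itv.
by apply: xP; rewrite /= ji.
Qed.

Lemma slice_int_pbox (P : pred 'I_n) a b i (c : R) x : P i -> 0 <= c ->
  - M <= a 0 i -> a 0 i <= b 0 i -> b 0 i <= M ->
  slice_int M i (fun y => (c * \1_(pbox P a b) y)%:E) x =
  (c * (b 0 i - a 0 i) * \1_(pbox [predD1 P & i] a b) x)%:E.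
Proof.
move=> Pi c0 Ma ab bM; rewrite /slice_int.
under eq_integral => t _ do rewrite pbox_upd// mulrA EFinM.
rewrite ge0_integralZl//; last 2 first.
- by apply/measurable_EFinP; exact: measurable_indic.
- by rewrite lee_fin mulr_ge0// indicE.
rewrite integral_indic// setIidl; last first.
  move=> t /=; rewrite !in_itv /= => /andP[/ltW at_ /ltW tb].
  by rewrite (le_trans Ma)//= (le_trans tb).
rewrite [X in (_ * X)%E = _]lebesgue_measure_itv /= lte_fin.
case: ifPn => [_|]; first by rewrite -EFinB -EFinM mulrAC.
rewrite -leNgt => ba; rewrite (le_anti (introT andP (conj ab ba))).
by rewrite subrr !(mulr0,mul0r) mule0.
Qed.

Lemma iter_int_pbox s (a b : 'rV[R]_n) : uniq s ->
  (forall i, [/\ - M <= a 0 i, a 0 i <= b 0 i & b 0 i <= M]) ->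
  iter_int s (fun x => (\1_(obox a b) x)%:E) =
  fun x => ((\prod_(i <- s) (b 0 i - a 0 i)) *
            \1_(pbox [pred i | i \notin s] a b) x)%:E.
Proof.
move=> + ab; elim: s => [_|i s IH /= /andP[is_ us]].
  apply/funext => x /=; rewrite big_nil mul1r; congr (\1_ _ _)%:E.
  by apply/seteqP; split=> y yab j //; exact: yab.
rewrite IH//; apply/funext => x; have [Ma abi bM] := ab i.
rewrite slice_int_pbox//; last first.
  by apply: prodr_ge0 => j _; rewrite subr_ge0; have [] := ab j.
rewrite big_cons (mulrC (b 0 i - _)); congr (_ * \1_(pbox _ _ _) _)%:E.
by apply/funext => j /=; rewrite inE negb_or.
Qed.

Lemma iter_int_obox s (a b x : 'rV[R]_n) : perm_eq s (enum 'I_n) ->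
  (forall i, [/\ - M <= a 0 i, a 0 i <= b 0 i & b 0 i <= M]) ->
  iter_int s (fun x => (\1_(obox a b) x)%:E) x =
  (\prod_(i < n) (b 0 i - a 0 i))%:E.
Proof.
move=> sP ab; rewrite iter_int_pbox//; last by rewrite (perm_uniq sP) enum_uniq.
rewrite (perm_big _ sP) big_enum/= [X in _ * X](_ : _ = 1) ?mulr1//.
rewrite indicE mem_set// => i /=.
by rewrite (perm_mem sP) mem_enum.
Qed.

Lemma open_obox (a b : 'rV[R]_n) : open (obox a b).
Proof.
rewrite openE => x xab.
suff : \forall y \near nbhs x, forall i, a 0 i < (y : 'rV[R]_n) 0 i < b 0 i by [].
apply: filter_forall => i.
have : open ((fun y : 'rV[R]_n => y 0 i) @^-1` `]a 0 i, b 0 i[).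
  by apply: open_comp; [move=> y _; exact: coord_continuous|exact: itv_open].
rewrite openE => /(_ x); rewrite /= in_itv /= => /(_ (xab i)).
by apply: filterS => y /=; rewrite in_itv.
Qed.

(** The maximal dyadic cubes of [W] have disjoint interiors contained in [W], hence
    finite sums of the indicators of these interiors are at most that of [W]. *)
Lemma open_cover_iter_int (W : set 'rV[R]_n) s (e : R) : (0 < n)%N -> open W ->
  (forall x, W x -> forall i, - M <= x 0 i <= M) -> perm_eq s (enum 'I_n) ->
  (iter_int s (fun y => (\1_W y)%:E) 0 <= e%:E)%E ->
  exists a b : nat -> 'rV[R]_n,
    [/\ forall k i, a k 0 i <= b k 0 i, W `<=` \bigcup_k box (a k) (b k) &
        (\sum_(0 <= k <oo) (\prod_(i < n) (b k 0 i - a k 0 i))%:E <= e%:E)%E].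
Proof.
move=> n0 oW WM sP We.
have [a [b [ab Wab abW tab]]] := open_dyadic_decomposition n0 oW.
exists a, b; split=> //.
have abM k i : [/\ - M <= a k 0 i, a k 0 i <= b k 0 i & b k 0 i <= M].
  have [kW|[ak bk]] := abW k; last by rewrite ak bk mxE oppr_le0 ltW.
  split=> //.
    have /WM/(_ i)/andP[]// : W (a k) by apply: kW => j; rewrite lexx ab.
  have /WM/(_ i)/andP[]// : W (b k) by apply: kW => j; rewrite lexx ab.
have vol0 k : (0 <= (\prod_(i < n) (b k 0 i - a k 0 i))%:E :> \bar R)%E.
  by rewrite lee_fin; apply: prodr_ge0 => i _; rewrite subr_ge0.
have oab k : open (obox (a k) (b k)) by exact: open_obox.
have lW : lsc_ge0 (fun y : 'rV[R]_n => (\1_W y)%:E) by exact: lsc_ge0_indic.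
have lab k : lsc_ge0 (fun y => (\1_(obox (a k) (b k)) y)%:E).
  exact: lsc_ge0_indic.
apply: lime_le; first by apply: is_cvg_nneseries => k *; exact: vol0.
apply: nearW => K; apply: le_trans We.
under eq_bigr => k _ do rewrite -(iter_int_obox 0 sP (abM k)).
rewrite -iter_int_sum//; apply: le_iter_int => // [|y].
  exact: lsc_ge0_sum.
rewrite sumEFin lee_fin.
(* At most one of the open cubes contains [y]. *)
have [[k0 k0y]|yab] := pselect (exists k, obox (a k) (b k) y); last first.
  rewrite big1 ?indicE// => k _; rewrite indicE memNset//.
  by move=> ky; apply: yab; exists k.
have Wy : W y.
  have [kW|[ak bk]] := abW k0.
    by apply: kW => i; case/andP: (k0y i) => /ltW-> /ltW->.
  by have := k0y (Ordinal n0); rewrite ak bk mxE => /andP[/lt_trans h /h]; rewrite ltxx.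
have dis k : k != k0 -> \1_(obox (a k) (b k)) y = 0 :> R.
  move=> kk0; rewrite indicE memNset// => ky; move/eqP: kk0; apply.
  by apply: (tab k k0) => //; exists y.
rewrite [leRHS]indicE mem_set//=; have [k0K|Kk0] := ltnP k0 K.
  rewrite big_mkord (bigD1 (Ordinal k0K))//= big1 => [|k /dis //].
  by rewrite addr0 indicE lern1 leq_b1.
rewrite big1_seq// => k; rewrite mem_index_iota => /andP[_ /andP[_ kK]].
by apply: dis; rewrite ltn_eqF// (leq_trans kK).
Qed.


End BoxIntegral.

(** * Null sets from null slices *)

(** A form of Tonelli's theorem. When the [i]-th coordinate is integrated first,
    dominated convergence makes the iterated integrals of the indicators of the
    finite intersections of the [W m] tend to 0, and these integrals bound the
    volumes of covers by dyadic cubes. *)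
Lemma Gdelta_null (R : realType) (n : nat) (W : nat -> set 'rV[R]_n) (i : 'I_n) :
  (forall m, open (W m)) ->
  (forall x, (@lebesgue_measure R).-negligible
     [set t | forall m, W m (upd x i t)]) ->
  lebesgue_null (\bigcap_m W m).
Proof.
move=> oW Wi.
(* Truncation to bounded cubes provides the domination. *)
pose c (K : nat) : 'rV[R]_n := const_mx K.+1%:R.
apply: (@lebesgue_nullS _ _ _
    (\bigcup_K ((\bigcap_m W m) `&` obox (- c K) (c K)))).
  move=> x Wx.
  exists (Num.bound `|x|) => //; split=> // j; rewrite !mxE -ltr_norml.
  apply: le_lt_trans (coord_le_norm _ _) _.
  by apply: lt_trans (archi_boundP _) _ => //; rewrite ltr_nat.
apply: lebesgue_null_bigcup => K e e0.
pose V m := (\big[setI/setT]_(j < m.+1) W j) `&` obox (- c K) (c K).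
have oV m : open (V m).
  apply: openI; last exact: open_obox.
  by apply: big_ind => //; [exact: openT|exact: openI].
have M0 : 0 < K.+1%:R :> R by [].
pose s := rcons (rem i (enum 'I_n)) i.
have sP : perm_eq s (enum 'I_n).
  rewrite perm_sym; apply: perm_trans (perm_to_rem (mem_enum _ i)) _.
  by rewrite perm_sym perm_rcons.
have VW m x : V m x -> forall j, (j <= m)%N -> W j x.
  by move=> [+ _] j jm; rewrite -bigcap_mkord; apply.
have cvg0 : iter_int K.+1%:R s (fun y => (\1_(V m) y)%:E) 0 @[m --> \oo] --> (0 : \bar R).
  apply: iter_int_cvg0 => // [m|m y|x].
  - exact: lsc_ge0_indic.
  - by rewrite lee_fin indicE lern1 leq_b1.
  apply: negligibleS (Wi x) => t /= nt m.
  apply: contrapT => nW; apply: nt.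
  apply: cvg_near_cst; near=> k.
  rewrite indicE memNset// => /VW /(_ m) Wm; apply: nW; apply: Wm.
  by near: k; exact: nbhs_infty_ge.
have [m _ /(_ m (leqnn _)) me] : \forall m \near \oo,
    (iter_int K.+1%:R s (fun y => (\1_(V m) y)%:E) 0 < e%:E)%E.
  apply: (cvg0 [set y | y < e%:E]%E); apply: open_nbhs_nbhs; split.
    exact: open_ereal_lt_ereal.
  by rewrite /= lte_fin.
have n0 : (0 < n)%N by case: (n) i {Wi s sP cvg0 m me} => // -[].
have [|a [b [ab Vab sab]]] := open_cover_iter_int M0 n0 (oV m) _ sP (ltW me).
  by move=> x [_ xc] j; have := xc j; rewrite !mxE => /andP[/ltW-> /ltW->].
exists a, b; split=> // x [Wx xc]; apply: Vab; split=> //.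
by rewrite -bigcap_mkord => j _; exact: Wx.
Unshelve. all: by end_near. Qed.

(** * Lipschitz functions of one real variable *)

(** Differentiability in a form without division, which includes [t = 0]. *)
Definition has_slope (R : realType) (f : R -> R) (x l : R) := forall e : R, 0 < e ->
  exists2 d : R, 0 < d & forall t, `|t| <= d -> `|f (x + t) - f x - l * t| <= e * `|t|.

Lemma derivable_has_slope (R : realType) (f : R -> R) (x : R) :
  derivable f x 1 -> has_slope f x ('D_1 f x).
Proof.
move=> df e e0.
have : nbhs (0 : R) (fun h => h != 0 ->
    `|'D_1 f x - h^-1 *: ((f \o shift x) h%:A - f x)| <= e).
  exact: (@cvgr_dist_le _ _ _ _ _ _ _ df e e0).
move=> /nbhs_distP[d d0 H]; exists (d / 2); first by rewrite divr_gt0.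
move=> t td; have [->|t0] := eqVneq t 0.
  by rewrite addr0 subrr mulr0 subr0 normr0 mulr0.
have := H t; rewrite /= sub0r normrN.
have td' : `|t| < d by apply: le_lt_trans td _; rewrite ltr_pdivrMr// ltr_pMr// ltr1n.
move=> /(_ td' t0); rewrite -/(derive f x 1) => {}H.
rewrite -ler_pdivrMr ?normr_gt0// -normfV -normrM.
rewrite mulrBl mulfK// -normrN opprB; apply: le_trans H.
by rewrite [t%:A]mulr1 (addrC t) [t^-1 *: _]mulrC.
Qed.

Section LipschitzLine.
Variables (R : realType) (f : R -> R) (L : R).
Hypothesis fL : forall x y, `|f x - f y| <= L * `|x - y|.
Local Notation mu := (@lebesgue_measure R).

Let g x := f x + L * x.

Let g_incr x y : x <= y -> 0 <= g y - g x <= 2 * L * (y - x).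
Proof.
move=> xy; have := fL y x; rewrite [X in L * X]ger0_norm ?subr_ge0// ler_norml.
by rewrite /g => /andP[? ?]; apply/andP; split; lra.
Qed.

Let g_nd : {homo g : x y / x <= y}.
Proof. by move=> x y /g_incr/andP[+ _]; rewrite subr_ge0. Qed.

Let g_rc : right_continuous g.
Proof.
apply: right_continuousW => x; apply: (@cvgD _ R^o).
  apply/cvgrPdist_le => e e0; near=> y.
  apply: le_trans (fL _ _) _; apply: (@le_trans _ _ ((`|L| + 1) * `|x - y|)).
    by rewrite ler_wpM2r// (le_trans (ler_norm _))// lerDl.
  rewrite mulrC -ler_pdivlMr ?ltr_pwDr//; near: y.
  by apply: cvgr_dist_le => //; rewrite divr_gt0// ltr_pwDr.
apply: cvgM; [exact: cvg_cst|exact: cvg_id].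
Unshelve. all: by end_near. Qed.

Let G : cumulative R R := HB.pack g (isCumulative.Build R _ R g g_nd g_rc).

Let nu : {measure set (measurableTypeR R) -> \bar R} := lebesgue_stieltjes_measure G.

Let nu_itv a b : a <= b -> nu `]a, b]%classic = (g b - g a)%:E.
Proof.
move=> ab; rewrite [LHS](_ : _ = mu_ext (wlength G) `]a, b]%classic)//.
rewrite measurable_mu_extE; last exact: is_ocitv.
by rewrite /= wlength_itv_bnd.
Qed.

(** A cover of [A] by intervals has a [nu]-length at most [2 * L] times its
    Lebesgue length. *)
Let nu_ac A : mu A = 0%E -> nu A = 0%E.
Proof.
move=> A0; apply/eqP; rewrite eq_le measure_ge0 andbT.
apply/lee_addgt0Pr => e e0; rewrite add0e.
pose c := e / (`|2 * L| + 1); have c0 : 0 < c by rewrite divr_gt0// ltr_pwDr.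
have : (mu A < c%:E)%E by rewrite A0 lte_fin.
move=> /ereal_inf_lt[_ [B [mB AB] <-] Bc].
apply: (@le_trans _ _ (\sum_(k <oo) wlength G (B k))%E).
  by apply: ereal_inf_lbound; exists B.
apply: (@le_trans _ _ (\sum_(k <oo) (`|2 * L| + 1)%:E * wlength idfun (B k))%E).
  apply: lee_nneseries => k _ *; first exact: wlength_ge0.
  have [->|[[a b] /= ab ->]] := (ocitvP _).1 (mB k).
    by rewrite !wlength0 mule0.
  rewrite !wlength_itv_bnd ?(ltW ab)// -EFinM lee_fin /=.
  have /andP[_ h] := g_incr (ltW ab); apply: le_trans h _.
  rewrite ler_wpM2r ?subr_ge0 ?(ltW ab)// (le_trans (ler_norm _))// lerDl//.
rewrite nneseriesZl => [|k _]; last exact: wlength_ge0.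
apply: le_trans (lee_wpmul2l _ (ltW Bc)) _; first by rewrite lee_fin addr_ge0.
by rewrite -EFinM lee_fin /c mulrCA divff ?mulr1// gt_eqF// ltr_pwDr.
Qed.

(** The function [g x = f x + L x] is nondecreasing and its Stieltjes measure is
    absolutely continuous, hence has a density by the Radon-Nikodym theorem;
    [g] is then locally an indefinite integral, and Lebesgue's differentiation
    theorem applies. *)
Lemma lipschitz_ae_slope : mu.-negligible [set x | ~ exists l, has_slope f x l].
Proof.
pose I (K : nat) : set R := `](- K.+1%:R), K.+1%:R]%classic.
suff : mu.-negligible (\bigcup_K ([set x | ~ exists l, has_slope f x l] `&`
    `](- K.+1%:R), K.+1%:R[%classic)).
  apply: negligibleS => x nx; exists (Num.bound `|x|) => //; split=> //=.
  rewrite in_itv /= -ltr_norml; apply: lt_trans (archi_boundP _) _ => //.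
  by rewrite ltr_nat.
apply: negligible_bigcup => K.
have mI : measurable (I K : set (measurableTypeR R)) by exact: measurable_itv.
have nuI : (nu (I K) < +oo)%E.
  have KK : - K.+1%:R <= K.+1%:R :> R by rewrite (@le_trans _ _ 0)// oppr_le0.
  by rewrite nu_itv// ltry.
pose nuK : {finite_measure set (measurableTypeR R) -> \bar R} := mfrestr mI nuI.
have ac : nuK `<< mu.
  apply/null_content_dominatesP => S mS S0.
  apply: nu_ac; apply: (@subset_measure0 _ _ _ mu _ S) => //; first exact: measurableI.
have [h [h0 hfin inth hE]] := radon_nikodym_sigma_finite ac.
have hfE : EFin \o (fine \o h) = h by apply/funext => x /=; rewrite fineK.
have inthB A : measurable A -> mu.-integrable A (EFin \o (fine \o h)).
  by move=> mA; rewrite hfE; exact: integrableS inth.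
have := @FTC1 R (fine \o h) (BRight (- K.+1%:R)) (fun y => inthB _ (measurable_itv _))
  (open_integrable_locally openT (inthB _ measurableT)).
set F := fun x : R => _; apply: negligibleS => x [nx].
rewrite /= in_itv /= => /andP[Kx xK] /(_ Kx)[/derivable_has_slope dF _].
apply: nx; exists ('D_1 F x - L) => e /dF[d d0 Hd].
have FE y : - K.+1%:R < y -> y <= K.+1%:R -> F y = g y - g (- K.+1%:R).
  move=> Ky yK; rewrite /F /Rintegral.
  under eq_integral do rewrite /= fineK//.
  rewrite -hE; last exact: measurable_itv.
  rewrite /nuK /= /mfrestr /mrestr /= setIidl; last first.
    by move=> z; rewrite /I /= !in_itv /= => /andP[-> /le_trans->].
  by rewrite nu_itv// ltW.
exists (Num.min d (Num.min (K.+1%:R - x) ((x + K.+1%:R) / 2))) => [|t].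
  by rewrite !lt_min d0 subr_gt0 xK divr_gt0// -ltrBlDr sub0r.
rewrite !le_min => /and3P[td tK1 tK2]; have := Hd t td.
move: tK1 tK2; rewrite !ler_norml => /andP[? ?] /andP[? ?].
rewrite !FE; [|lra..]; rewrite /g -!ler_norml.
by apply: le_trans; rewrite le_eqVlt; apply/orP; left; apply/eqP; congr (`|_|); ring.
Qed.

End LipschitzLine.

(** * Rademacher's theorem *)

Section Rademacher.
Variables (R : realType) (n : nat).
Implicit Types (x y h p g : 'rV[R]_n) (i : 'I_n) (f : 'rV[R]_n -> R) (A : set 'rV[R]_n)
  (q e d t L : R).
Local Notation mu := (@lebesgue_measure R).

Definition basis_vec i : 'rV[R]_n := delta_mx 0 i.

Lemma basis_vecE i j : basis_vec i 0 j = (j == i)%:R.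
Proof. by rewrite mxE. Qed.

Definition lipschitz_fun f (L : R) := forall x y, `|f x - f y| <= L * `|x - y|.

Definition line_affine f i q e d x := forall t, `|t| <= d ->
  `|f (x + t *: basis_vec i) - f x - q * t| <= e * `|t|.

(** The slope is allowed to depend on the precision [e]. This weaker form of
    differentiability along an axis is enough below, and involves no limit:
    only slopes and scales that may be taken in countable sets. *)
Definition nearly_affine f i x := forall e : R, 0 < e ->
  exists q d, 0 < d /\ line_affine f i q e d x.

Lemma norm_delta i : `|basis_vec i| = 1.
Proof.
apply/eqP; rewrite eq_le; apply/andP; split.
  apply: norm_le_coord => // j; rewrite basis_vecE.
  by case: eqP => _; rewrite ?normr1 ?normr0.
by have := coord_le_norm (basis_vec i) i; rewrite basis_vecE eqxx normr1.
Qed.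

Lemma norm_scale_delta (t : R) i : `|t *: basis_vec i| = `|t|.
Proof. by rewrite normrZ norm_delta mulr1. Qed.

Lemma upd_add_delta x i t s : upd x i t + s *: basis_vec i = upd x i (t + s).
Proof.
apply/rowP => j; rewrite !mxE eqxx /=.
by case: eqP; rewrite ?mulr1 ?mulr0 ?addr0.
Qed.

Lemma dotp_delta p i : dotp p (basis_vec i) = p 0 i.
Proof.
rewrite /dotp (bigD1 i)//= basis_vecE eqxx mulr1 big1 ?addr0// => j ji.
by rewrite basis_vecE (negbTE ji) mulr0.
Qed.

Lemma ratr_approx (x e : R) : 0 < e -> exists q : rat, `|x - ratr q| <= e.
Proof.
move=> e0; have /rat_in_itvoo[q] : x - e < x + e by rewrite ltrD2l gtrN.
rewrite in_itv /= => /andP[? ?]; exists q; rewrite ler_norml; lra.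
Qed.

Lemma invSn_le (e : R) : 0 < e -> exists k : nat, k.+1%:R^-1 <= e.
Proof.
move=> e0; have [k _ /(_ k (leqnn _))/ltW kd] := near_infty_natSinv_lt (PosNum e0).
by exists k.
Qed.

Lemma open_not_line_affine f L i q e d : 0 <= L -> lipschitz_fun f L ->
  open (~` (line_affine f i q e d)).
Proof.
move=> L0 fL; rewrite openE => x /existsNP[t /not_implyP[td /negP]].
rewrite -ltNge; set v := `|_ - _| => vt.
apply/nbhs_distP; exists ((v - e * `|t|) / (2 * L + 1)).
  rewrite divr_gt0 ?subr_gt0//; lra.
have L1 : 0 < 2 * L + 1 by lra.
move=> y; rewrite ltr_pdivlMr// => xy /(_ t td); apply/negP.
rewrite -ltNge.
have h1 := fL (x + t *: basis_vec i) (y + t *: basis_vec i); have h2 := fL x y.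
rewrite opprD addrACA subrr addr0 in h1.
have : v <= `|f (y + t *: basis_vec i) - f y - q * t|
    + `|f (x + t *: basis_vec i) - f (y + t *: basis_vec i)| + `|f x - f y|.
  rewrite /v -(normrN (f x - f y)).
  apply: le_trans _ (lerD (ler_normD _ _) (lexx _)).
  apply: le_trans _ (ler_normD _ _).
  by rewrite le_eqVlt; apply/orP; left; apply/eqP; congr `|_|; ring.
have := normr_ge0 (x - y); lra.
Qed.

(** On every line parallel to the [i]-th axis this is the one-dimensional
    theorem. With rational slopes [q] and scales 1 / (k + 1), the points that fail
    at a given precision form a countable intersection of open sets, to which
    [Gdelta_null] applies. *)
Lemma lipschitz_ae_nearly_affine f L i : 0 <= L -> lipschitz_fun f L ->
  lebesgue_null [set x | ~ nearly_affine f i x].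
Proof.
move=> L0 fL.
pose W (l m : nat) := if @pickle_inv (rat * nat)%type m is Some c then
  ~` (line_affine f i (ratr c.1) l.+1%:R^-1 c.2.+1%:R^-1) else setT.
apply: (@lebesgue_nullS _ _ _ (\bigcup_l \bigcap_m W l m)).
  move=> x nx; apply: contrapT => xW; apply: nx => e /invSn_le[l le].
  have : ~ (\bigcap_m W l m) x by move=> h; apply: xW; exists l.
  move=> /existsNP[m /not_implyP[_]]; rewrite /W.
  case: pickle_inv => [[q k] /= /contrapT H|]; last by move=> /(_ I).
  exists (ratr q), k.+1%:R^-1; split; first by rewrite invr_gt0.
  by move=> t /H /le_trans; apply; rewrite ler_wpM2r.
apply: lebesgue_null_bigcup => l; apply: (@Gdelta_null _ _ _ i) => [m|x].
  rewrite /W; case: pickle_inv => [c|]; last exact: openT.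
  exact: open_not_line_affine L0 fL.
have fxL s t : `|f (upd x i s) - f (upd x i t)| <= L * `|s - t|.
  apply: le_trans (fL _ _) _; rewrite ler_wpM2l//.
  apply: le_trans (upd_dist _ _ _ _ _) _.
  by rewrite subrr normr0 max_r.
apply: negligibleS (lipschitz_ae_slope fxL) => t Wt [v fv].
have l0 : 0 < l.+1%:R^-1 / 2 :> R by rewrite divr_gt0// invr_gt0.
have [d d0 Hd] := fv _ l0; have [k kd] := invSn_le d0.
have [q vq] := ratr_approx v l0.
have := Wt (pickle (q, k)); rewrite /W pickleK_inv; apply=> s sk /=.
rewrite upd_add_delta; have := Hd s (le_trans sk kd).
have : `|(v - ratr q) * s| <= l.+1%:R^-1 / 2 * `|s| by rewrite normrM ler_wpM2r.
move=> h1 h2.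
rewrite [leRHS](_ : _ = l.+1%:R^-1 / 2 * `|s| + l.+1%:R^-1 / 2 * `|s|); last by field.
apply: le_trans _ (lerD h2 h1); apply: le_trans _ (ler_normD _ _).
by rewrite le_eqVlt; apply/orP; left; apply/eqP; congr `|_|; ring.
Qed.

Definition set_dist A x : R := inf [set `|x - y| | y in A].

Lemma set_dist_le A x y : A y -> set_dist A x <= `|x - y|.
Proof. by move=> Ay; apply: ge_inf; [exists 0 => _ [z _ <-]|exists y]. Qed.

Lemma set_dist_ge0 A x : 0 <= set_dist A x.
Proof.
rewrite /set_dist; have [->|/set0P[y Ay]] := eqVneq A set0.
  by rewrite image_set0 inf0.
by apply: lb_le_inf; [exists `|x - y|; exists y => //|move=> _ [z _ <-]].
Qed.

Lemma set_dist_lt A x e : A !=set0 -> set_dist A x < e ->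
  exists2 y, A y & `|x - y| < e.
Proof.
move=> [y Ay] xe; have [|_ [z Az <-] ze] := @inf_lt _ [set `|x - y| | y in A] e _ xe.
  by exists `|x - y|; exists y.
by exists z.
Qed.

Lemma set_dist_lipschitz A : lipschitz_fun (set_dist A) 1.
Proof.
have [->|/set0P A0] := eqVneq A set0.
  by move=> x y; rewrite /set_dist !image_set0 subrr normr0 mul1r.
suff H x y : set_dist A x <= set_dist A y + `|x - y|.
  by move=> x y; rewrite mul1r ler_distl H (distrC x) lerBlDr H.
rewrite leNgt; apply/negP; rewrite -ltrBrDr => /set_dist_lt -/(_ A0)[z Az].
rewrite ltrBrDr ltNge => /negP; apply; apply: le_trans (set_dist_le _ Az) _.
by rewrite [leRHS]addrC ler_distD.
Qed.

(** The distance to [A] is minimal at [x], so its slope there can only be 0: the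
    set [A] comes closer to [x + t e_i] than any fixed multiple of [`|t|]. *)
Lemma nearly_affine_set_dist A i x : A x -> nearly_affine (set_dist A) i x ->
  forall e : R, 0 < e -> exists2 d : R, 0 < d &
    forall t, `|t| <= d -> exists2 y, A y & `|x + t *: basis_vec i - y| <= e * `|t|.
Proof.
move=> Ax Dx e e0.
have Dx0 : set_dist A x = 0.
  apply/le_anti; rewrite set_dist_ge0 andbT.
  by apply: le_trans (set_dist_le x Ax) _; rewrite subrr normr0.
have e4 : 0 < e / 4 by rewrite divr_gt0.
have [q [d [d0 Hd]]] := Dx _ e4.
exists d => // t td; have [->|t0] := eqVneq t 0.
  by exists x => //; rewrite scale0r addr0 subrr !normr0 mulr0.
have := Hd t td; have := Hd (- t); rewrite normrN => /(_ td).
rewrite Dx0 !subr0 !ler_norml => /andP[_ h1] /andP[_ h2].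
have h3 := set_dist_ge0 A (x + - t *: basis_vec i).
have et : 0 < e * `|t| by rewrite mulr_gt0// normr_gt0.
have [||y Ay] := @set_dist_lt A (x + t *: basis_vec i) (e * `|t|).
- by exists x.
- lra.
by exists y => //; exact: ltW.
Qed.

Definition supported (j : nat) h := forall i, (j <= i)%N -> h 0 i = 0.

Definition ball_linear f (j : nat) p e d x := forall h, supported j h -> `|h| <= d ->
  `|f (x + h) - f x - dotp p h| <= e * `|h|.

Definition nearly_linear f j x := forall e : R, 0 < e ->
  exists p d, 0 < d /\ ball_linear f j p e d x.

(** To move by [h = k + t e_i] from [x], go first to a point [y] of [A] close to
    [x + t e_i], where the linear approximation along [k] holds with the same
    constants as at [x]. *)
Lemma ball_linear_step f L i p e d d' x : 0 <= L -> 0 <= e -> lipschitz_fun f L ->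
  let A := ball_linear f i p e d `&` line_affine f i (p 0 i) e d in
  A x ->
  (forall t, `|t| <= d' -> exists2 y, A y & `|x + t *: basis_vec i - y| <= e * `|t|) ->
  ball_linear f i.+1 p ((2 * L + 2) * e) (Num.min d d') x.
Proof.
move=> L0 e0 fL A [_ xl] Ay h hs; rewrite le_min => /andP[hd hd'].
set t := h 0 i; have th : `|t| <= `|h| := coord_le_norm h i.
pose k := h - t *: basis_vec i.
have kE j : k 0 j = if j == i then 0 else h 0 j.
  rewrite !mxE eqxx /=; case: (eqVneq j i) => [->|ji]; rewrite ?mulr1 ?subrr//.
  by rewrite mulr0 subr0.
have ks : supported i k.
  move=> j ij; rewrite kE; case: eqVneq => // ji; apply: hs.
  by rewrite ltn_neqAle ij andbT eq_sym.
have kh : `|k| <= `|h|.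
  apply: norm_le_coord => // j; rewrite kE; case: eqP => _; rewrite ?normr0//.
  exact: coord_le_norm.
have hE : h = t *: basis_vec i + k by rewrite addrC subrK.
clearbody k.
have [y [yb _] xy] := Ay t (le_trans th hd').
have h1 := fL (x + t *: basis_vec i + k) (y + k).
rewrite opprD addrACA subrr addr0 in h1.
have h2 := yb k ks (le_trans kh hd).
have h3 := fL (x + t *: basis_vec i) y.
have h4 := xl t (le_trans th hd).
have -> : f (x + h) - f x - dotp p h =
    (f (x + t *: basis_vec i + k) - f (y + k)) + (f (y + k) - f y - dotp p k)
    - (f (x + t *: basis_vec i) - f y) + (f (x + t *: basis_vec i) - f x - p 0 i * t).
  rewrite {1 2}hE dotpDr dotpZr dotp_delta addrA; ring.
apply: le_trans (ler_normD _ _) _; apply: le_trans (lerD (ler_normB _ _) (lexx _)) _.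
apply: le_trans (lerD (lerD (ler_normD _ _) (lexx _)) (lexx _)) _.
have Lxy : L * `|x + t *: basis_vec i - y| <= L * (e * `|h|).
  by rewrite ler_wpM2l// (le_trans xy)// ler_wpM2l.
have ek : e * `|k| <= e * `|h| by rewrite ler_wpM2l.
have et : e * `|t| <= e * `|h| by rewrite ler_wpM2l.
lra.
Qed.

Lemma ratr_vec_approx p (e : R) : 0 < e ->
  exists q : {ffun 'I_n -> rat}, `|p - \row_i ratr (q i)| <= e.
Proof.
move=> e0; have /fin_all_exists[q pq] i := ratr_approx (p 0 i) e0.
exists (finfun q); apply: norm_le_coord => [|i]; first exact: ltW.
by rewrite !mxE ffunE.
Qed.

(** Induction on the number of coordinates. The step from [j] to [j + 1] fails only
    where [f], or one of the functions [set_dist A] for countably many sets [A],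
    is not nearly affine along the next axis; each of these functions is
    Lipschitz. *)
Lemma lipschitz_ae_nearly_linear f L j : (0 < n)%N -> 0 <= L -> lipschitz_fun f L ->
  (j <= n)%N -> lebesgue_null [set x | ~ nearly_linear f j x].
Proof.
move=> n0 L0 fL; elim: j => [_|j IH jn].
  apply: (@lebesgue_nullS _ _ _ set0); last exact: lebesgue_null0.
  move=> x; apply => e e0.
  exists 0, 1; split=> // h h0 _; have -> : h = 0 by apply/rowP => i; rewrite h0// mxE.
  by rewrite addr0 subrr dotp0l subr0 !normr0 mulr0.
pose i := Ordinal jn.
pose A (c : {ffun 'I_n -> rat} * nat * nat) :=
  let p : 'rV[R]_n := \row_i ratr (c.1.1 i) in
  ball_linear f i p c.1.2.+1%:R^-1 c.2.+1%:R^-1 `&`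
  line_affine f i (p 0 i) c.1.2.+1%:R^-1 c.2.+1%:R^-1.
apply: (@lebesgue_nullS _ _ _ ([set x | ~ nearly_linear f j x] `|`
  ([set x | ~ nearly_affine f i x] `|`
   \bigcup_c [set x | ~ nearly_affine (set_dist (A c)) i x]))).
  move=> x nx; apply: contrapT => /not_orP[/contrapT fj /not_orP[/contrapT fi xA]].
  apply: nx => e e0.
  have [l le] : exists l : nat, l.+1%:R^-1 <= e / (2 * L + 2).
    by apply: invSn_le; rewrite divr_gt0// ltr_wpDl// mulr_ge0.
  have l0 : 0 < l.+1%:R^-1 / 2 :> R by rewrite divr_gt0// invr_gt0.
  have [p [d [d0 Hd]]] := fj _ l0; have [v [d' [d'0 Hd']]] := fi _ l0.
  have dd0 : 0 < Num.min d d' by rewrite lt_min d0.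
  have [k kd] := invSn_le dd0.
  have [kd1 kd2] : k.+1%:R^-1 <= d /\ k.+1%:R^-1 <= d'.
    by move: kd; rewrite le_min => /andP.
  (* One rational vector [r] approximates both the gradient [p] along the first
     coordinates and the slope [v] along the [i]-th axis. *)
  have ln : 0 < l.+1%:R^-1 / 2 / n%:R :> R by rewrite divr_gt0// ltr0n.
  have [q pq] := ratr_vec_approx (upd p i v) ln.
  set r := \row_i _ in pq.
  have Ax : A (q, l, k) x.
    split=> [h hs hk|t tk] /=; rewrite -/r.
      have -> : f (x + h) - f x - dotp r h =
          (f (x + h) - f x - dotp p h) + dotp (upd p i v - r) h.
        rewrite dotpBl [dotp (upd _ _ _) _](_ : _ = dotp p h); first by ring.
        apply: eq_bigr => i' _; rewrite mxE; case: eqP => // ->.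
        by rewrite hs ?mulr0.
      apply: le_trans (ler_normD _ _) _.
      rewrite [leRHS](_ : _ = l.+1%:R^-1 / 2 * `|h| + l.+1%:R^-1 / 2 * `|h|); last by field.
      apply: lerD; first by apply: Hd => //; exact: le_trans kd1.
      apply: le_trans (dotp_le_norm _ _) _; rewrite mulrA ler_wpM2r//.
      by rewrite mulrC -ler_pdivlMr ?ltr0n.
    have -> : f (x + t *: basis_vec i) - f x - r 0 i * t =
        (f (x + t *: basis_vec i) - f x - v * t) + (upd p i v - r) 0 i * t.
      by rewrite !mxE eqxx; ring.
    apply: le_trans (ler_normD _ _) _.
    rewrite [leRHS](_ : _ = l.+1%:R^-1 / 2 * `|t| + l.+1%:R^-1 / 2 * `|t|); last by field.
    apply: lerD; first by apply: Hd' => //; exact: le_trans kd2.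
    rewrite normrM ler_wpM2r// (le_trans (coord_le_norm _ _))// (le_trans pq)//.
    by rewrite ler_pdivrMr ?ltr0n// ler_peMr ?(ltW l0)// ler1n.
  have Dx : nearly_affine (set_dist (A (q, l, k))) i x.
    by apply: contrapT => nD; apply: xA; exists (q, l, k).
  have ll0 : 0 < l.+1%:R^-1 :> R by rewrite invr_gt0.
  have [d2 d20 Hd2] := nearly_affine_set_dist Ax Dx ll0.
  exists r, (Num.min k.+1%:R^-1 d2); split; first by rewrite lt_min d20 invr_gt0 ltr0n.
  have := ball_linear_step L0 (ltW ll0) fL Ax Hd2 => H h hs hd.
  apply: le_trans (H h hs hd) _; rewrite ler_wpM2r//.
  by rewrite mulrC -ler_pdivlMr// ltr_wpDl// mulr_ge0.
apply: lebesgue_nullU; first exact/IH/ltnW.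
apply: lebesgue_nullU; first exact: lipschitz_ae_nearly_affine L0 fL.
apply: lebesgue_null_bigcup_count => [|c]; first exact: lebesgue_null0.
exact: lipschitz_ae_nearly_affine ler01 (set_dist_lipschitz _).
Qed.

Definition has_gradient f x g := forall e : R, 0 < e ->
  exists2 d : R, 0 < d & forall h, `|h| <= d ->
    `|f (x + h) - f x - dotp g h| <= e * `|h|.

(** The approximate gradients [p_k], of precision 1 / (k + 1), form a Cauchy
    sequence; its limit is caught as a supremum of lower bounds. *)
Lemma nearly_linear_has_gradient f x : nearly_linear f n x ->
  exists g, has_gradient f x g.
Proof.
move=> fx.
have /choice[pd Hpd] (k : nat) : exists pd : 'rV[R]_n * R, 0 < pd.2 /\
    forall h, `|h| <= pd.2 ->
      `|f (x + h) - f x - dotp pd.1 h| <= k.+1%:R^-1 * `|h|.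
  have k0 : 0 < k.+1%:R^-1 :> R by rewrite invr_gt0.
  have [p [d [d0 Hd]]] := fx _ k0; exists (p, d); split=> // h; apply: Hd => i.
  by rewrite leqNgt ltn_ord.
pose p k := (pd k).1.
have pp k l i : p k 0 i - k.+1%:R^-1 <= p l 0 i + l.+1%:R^-1.
  have [dk0 Hk] := Hpd k; have [dl0 Hl] := Hpd l.
  pose t := Num.min (pd k).2 (pd l).2.
  have t0 : 0 < t by rewrite lt_min dk0.
  have tn : `|t *: basis_vec i| = t by rewrite norm_scale_delta gtr0_norm.
  have tk : `|t *: basis_vec i| <= (pd k).2 by rewrite tn ge_min lexx.
  have tl : `|t *: basis_vec i| <= (pd l).2 by rewrite tn ge_min lexx orbT.
  have := Hk _ tk; have := Hl _ tl.
  rewrite tn !dotpZr !dotp_delta !ler_norml -/(p k) -/(p l) => /andP[h1 h2] /andP[h3 h4].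
  rewrite -(ler_pM2l t0).
  by move: (k.+1%:R^-1) (l.+1%:R^-1) h2 h3 => a b h2 h3; clear -h2 h3; lra.
pose g : 'rV[R]_n := \row_i sup [set p k 0 i - k.+1%:R^-1 | k in setT].
have gp k : `|g - p k| <= k.+1%:R^-1.
  apply: norm_le_coord => [|i]; first by rewrite invr_ge0.
  rewrite !mxE ler_norml; apply/andP; split.
    rewrite lerBrDl; apply: ub_le_sup; last by exists k.
    by exists (p 0%N 0 i + 1%:R^-1) => _ [l _ <-].
  rewrite lerBlDl; apply: ge_sup; first by exists (p 0%N 0 i - 1%:R^-1), 0%N.
  by move=> _ [l _ <-].
exists g => e e0.
have n1 : 0 < n%:R + 1 :> R by rewrite ltr_wpDl.
have [k ke] := invSn_le (divr_gt0 e0 n1); have [dk0 Hk] := Hpd k.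
exists (pd k).2 => // h hd.
have -> : f (x + h) - f x - dotp g h =
    (f (x + h) - f x - dotp (p k) h) - dotp (g - p k) h by rewrite dotpBl; ring.
apply: le_trans (ler_normB _ _) _.
apply: le_trans (lerD (Hk h hd) (dotp_le_norm _ _)) _.
apply: (@le_trans _ _ ((n%:R + 1) * k.+1%:R^-1 * `|h|)).
  rewrite mulrDl mul1r mulrDl addrC lerD2r mulrA.
  by rewrite ler_wpM2r// ler_wpM2l.
by rewrite ler_wpM2r// mulrC -ler_pdivlMr.
Qed.

Theorem rademacher f L : (0 < n)%N -> 0 <= L -> lipschitz_fun f L ->
  lebesgue_ae (fun x => exists g, has_gradient f x g).
Proof.
move=> n0 L0 fL; apply: lebesgue_nullS _ (lipschitz_ae_nearly_linear n0 L0 fL (leqnn n)).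
by move=> x nx fx; apply: nx; exact: nearly_linear_has_gradient.
Qed.

End Rademacher.

(** * Differential of a map between row vectors *)

Lemma differential_unique (R : realType) (V W : normedModType R) (f : V -> W)
    (D : {linear V -> W}) (x : V) : continuous D ->
  (forall e : R, 0 < e -> exists2 d : R, 0 < d & forall h, `|h| <= d ->
     `|f (x + h) - f x - D h| <= e * `|h|) ->
  differentiable f x /\ 'd f x = D :> (V -> W).
Proof.
move=> Dc fB.
have fD : f \o shift x = cst (f x) + D +o_ 0 id.
  apply/eqaddoP => _/posnumP[e]; have [d d0 Hd] := fB _ (gt0 e).
  apply/nbhs_distP; exists d => // h; rewrite sub0r normrN => hd.
  rewrite /= !fctE /= opprD addrA (addrC h); exact/Hd/ltW.
have dE := diff_unique Dc fD.
by split=> //; apply/diff_locallyP; rewrite dE.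
Qed.

Lemma jacobian_unique (R : realType) (m n : nat) (f : 'rV[R]_m -> 'rV[R]_n) (x : 'rV[R]_m)
    (B : 'M[R]_(m, n)) :
  (forall e : R, 0 < e -> exists2 d : R, 0 < d & forall h : 'rV[R]_m, `|h| <= d ->
     `|f (x + h) - f x - h *m B| <= e * `|h|) ->
  differentiable f x /\ jacobian f x = B.
Proof.
move=> fB.
pose D : {linear 'rV[R]_m -> 'rV[R]_n} := mulmxr B.
have Dc : continuous D.
  apply/bounded_linear_continuous/linear_boundedP.
  exists (`|B| *+ m); split=> [|r Br h]; first exact: num_real.
  have r0 : 0 <= r by rewrite (le_trans _ (ltW Br))// mulrn_wge0.
  apply: norm_le_coord => [|j]; first by rewrite mulr_ge0.
  rewrite mxE; apply: le_trans (ler_norm_sum _ _ _) _.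
  apply: (@le_trans _ _ (\sum_(k < m) `|h| * `|B|)).
    apply: ler_sum => k _; rewrite normrM ler_pM// ?coord_le_norm//.
    by rewrite [leRHS]mx_normrE; apply/bigmax_geP; right; exists (k, j).
  rewrite sumr_const card_ord -mulrnAr mulrC ler_wpM2r//.
  exact: ltW.
have [dS dE] := differential_unique Dc fB; split=> //.
apply/row_matrixP => i; rewrite !rowE /jacobian mul_rV_lin1.
by rewrite dE.
Qed.

(** * Star-shaped domains *)

Section Radial.
Variables (R : realType) (n : nat).
Implicit Types (x y u v h : 'rV[R]_n) (c : 'rV[R]_n -> R).

(** Multiplying by a bounded function of the direction that is Lipschitz on the
    sphere is a Lipschitz operation: the directions of [x] and [y] differ by at
    most [2 |x - y| / |y|], a loss which the factor [y] compensates. *)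
Lemma elipschitz_radial c (C L : R) : 0 <= C -> 0 <= L ->
  (forall u, enorm u = 1 -> `|c u| <= C) ->
  (forall u v, enorm u = 1 -> enorm v = 1 -> `|c u - c v| <= L * enorm (u - v)) ->
  elipschitz (fun x => c (unit_vec x) *: x).
Proof.
move=> C0 L0 cC cL; exists (C + 2 * L).
have H0 y : enorm (c (unit_vec y) *: y) <= (C + 2 * L) * enorm y.
  have [->|y0] := eqVneq y 0; first by rewrite scaler0 enorm0 mulr0.
  rewrite enormZ ler_wpM2r ?enorm_ge0//.
  apply: le_trans (cC _ (enorm_unit_vec y0)) _; lra.
move=> x y; have [->|x0] := eqVneq x 0.
  by rewrite scaler0 !sub0r !enormN.
have [->|y0] := eqVneq y 0; first by rewrite scaler0 !subr0.
have -> : c (unit_vec x) *: x - c (unit_vec y) *: y =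
    c (unit_vec x) *: (x - y) + (c (unit_vec x) - c (unit_vec y)) *: y.
  by rewrite scalerBr scalerBl addrA subrK.
apply: le_trans (enormD _ _) _; rewrite !enormZ mulrDl lerD//.
  by rewrite ler_wpM2r ?enorm_ge0// cC// enorm_unit_vec.
apply: (@le_trans _ _ (L * enorm (unit_vec x - unit_vec y) * enorm y)).
  by rewrite ler_wpM2r ?enorm_ge0// cL// enorm_unit_vec.
have := ler_wpM2l L0 (unit_vec_dist y x0); lra.
Qed.

End Radial.

Section StarShaped.
Variables (R : realType) (n : nat) (rho r Rad : R).
Hypotheses (rho_gt0 : 0 < rho) (rho_le_r : rho <= r) (r_le_Rad : r <= Rad).
Variable Omega : set 'rV[R]_n.
Hypotheses (O_sub : Omega `<=` eball n Rad) (sub_O : eball n r `<=` Omega)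
  (starO : star_shaped (eball n rho) Omega).
Implicit Types (x y u v h g : 'rV[R]_n) (t : R).

Local Notation s := (expansion_fun Omega).

Let r_gt0 : 0 < r. Proof. exact: lt_le_trans rho_le_r. Qed.
Let Rad_gt0 : 0 < Rad. Proof. exact: lt_le_trans r_le_Rad. Qed.

Let ray_lt u t : enorm u = 1 -> 0 < t -> t < r -> Omega (t *: u).
Proof.
by move=> u1 t0 tr; apply: sub_O; rewrite /eball /= enormZ u1 mulr1 gtr0_norm.
Qed.

Let has_sup_ray u : enorm u = 1 -> has_sup [set t : R | 0 < t /\ Omega (t *: u)].
Proof.
move=> u1; split.
  have r0 : 0 < r := r_gt0; have r2 : 0 < r / 2 by rewrite divr_gt0.
  by exists (r / 2); split=> //; apply: ray_lt => //; lra.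
exists Rad => t [t0 /O_sub]; rewrite /eball /= enormZ u1 mulr1 gtr0_norm//.
exact: ltW.
Qed.

Let le_expansion u t : enorm u = 1 -> 0 < t -> Omega (t *: u) -> t <= s u.
Proof.
by move=> u1 t0 tO; apply: ub_le_sup; [exact: (has_sup_ray u1).2|].
Qed.

Let lt_expansion u t : enorm u = 1 -> 0 < t -> t < s u -> Omega (t *: u).
Proof.
move=> u1 t0 /(sup_gt (has_sup_ray u1).1)[t' [t'0 Ot'] tt'].
have -> : t *: u = (1 - (1 - t / t')) *: (t' *: u) + (1 - t / t') *: 0.
  by rewrite scaler0 addr0 scalerA opprB addrC subrK divfK// gt_eqF.
apply: starO.2 => //; first by rewrite /eball /= enorm0.
by rewrite subr_ge0 ler_pdivrMr// mul1r ltW//= lerBlDr lerDl divr_ge0// ltW.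
Qed.

Lemma expansion_ge u : enorm u = 1 -> r <= s u.
Proof.
move=> u1; rewrite leNgt; apply/negP => sr.
have r0 : 0 < r := r_gt0.
have r2 : 0 < r / 2 by rewrite divr_gt0.
have rs : r / 2 <= s u by apply: le_expansion => //; apply: ray_lt => //; lra.
have sr0 : 0 < (s u + r) / 2 by lra.
have : (s u + r) / 2 <= s u by apply: le_expansion => //; apply: ray_lt => //; lra.
lra.
Qed.

Lemma expansion_le u : enorm u = 1 -> s u <= Rad.
Proof.
move=> u1; apply: ge_sup; first exact: (has_sup_ray u1).1.
move=> t [t0 /O_sub]; rewrite /eball /= enormZ u1 mulr1 gtr0_norm//.
exact: ltW.
Qed.

Lemma expansion_gt0 u : enorm u = 1 -> 0 < s u.
Proof. by move=> /expansion_ge; exact: lt_le_trans. Qed.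

(** The Minkowski functional of [Omega]. Unlike [s] it extends from the sphere to a
    globally Lipschitz function, see [gauge_dist]. *)
Definition gauge x := enorm x / s (unit_vec x).

Lemma gauge0 : gauge 0 = 0.
Proof. by rewrite /gauge enorm0 mul0r. Qed.

Lemma gauge_ge0 x : 0 <= gauge x.
Proof.
have [->|x0] := eqVneq x 0; first by rewrite gauge0.
by rewrite divr_ge0 ?enorm_ge0// ltW// expansion_gt0// enorm_unit_vec.
Qed.

Lemma gaugeZ t x : 0 < t -> gauge (t *: x) = t * gauge x.
Proof. by move=> t0; rewrite /gauge unit_vecZ// enormZ gtr0_norm// mulrA. Qed.

Lemma gauge_unit u : enorm u = 1 -> gauge u = (s u)^-1.
Proof. by move=> u1; rewrite /gauge unit_vec_id// u1 mul1r. Qed.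

Lemma gauge_lt x t : gauge x < t -> Omega (t^-1 *: x).
Proof.
move=> xt; have t0 : 0 < t := le_lt_trans (gauge_ge0 x) xt.
have [->|x0] := eqVneq x 0.
  by rewrite scaler0; apply: sub_O; rewrite /eball /= enorm0.
have u1 := enorm_unit_vec x0; have xn : 0 < enorm x by rewrite enorm_gt0.
rewrite -[x in _ *: x]unit_vecK scalerA; apply: lt_expansion => //.
  by rewrite mulr_gt0// invr_gt0.
by move: xt; rewrite /gauge ltr_pdivrMr ?expansion_gt0// -ltr_pdivrMl.
Qed.

Lemma gauge_le x t : 0 < t -> Omega (t^-1 *: x) -> gauge x <= t.
Proof.
move=> t0; have [->|x0] := eqVneq x 0; first by rewrite gauge0 ltW.
have u1 := enorm_unit_vec x0; have xn : 0 < enorm x by rewrite enorm_gt0.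
rewrite -[x in _ *: x]unit_vecK scalerA => /le_expansion h.
rewrite /gauge ler_pdivrMr ?expansion_gt0// -ler_pdivrMl//.
by apply: h => //; rewrite mulr_gt0// invr_gt0.
Qed.

(** If [x / t] is in [Omega] and [w > |v| / rho] then [(x + v) / (t + w)] is a
    convex combination of [x / t] and of the point [v / w] of the ball. *)
Lemma gauge_add x v : gauge (x + v) <= gauge x + rho^-1 * enorm v.
Proof.
apply/ler_addgt0Pr => e e0.
pose t := gauge x + e / 2; pose w := rho^-1 * enorm v + e / 2.
have e2 : 0 < e / 2 by rewrite divr_gt0.
have t0 : 0 < t by rewrite ltr_wpDl ?gauge_ge0.
have w0 : 0 < w by rewrite ltr_wpDl// mulr_ge0 ?enorm_ge0// invr_ge0 ltW.
have -> : gauge x + rho^-1 * enorm v + e = t + w by rewrite /t /w; lra.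
have tw0 : 0 < t + w by rewrite addr_gt0.
apply: gauge_le => //.
have -> : (t + w)^-1 *: (x + v) =
    (1 - w / (t + w)) *: (t^-1 *: x) + (w / (t + w)) *: (w^-1 *: v).
  rewrite scalerDr !scalerA; congr (_ *: _ + _ *: _); field.
    by rewrite !gt_eqF.
  by rewrite !gt_eqF.
apply: starO.2.
- by apply: gauge_lt; rewrite /t ltrDl.
- rewrite /eball /= enormZ gtr0_norm ?invr_gt0// mulrC ltr_pdivrMr//.
  by rewrite -ltr_pdivrMl// /w ltrDl.
- by rewrite divr_ge0 ?(ltW w0) ?(ltW tw0)//= ler_pdivrMr// mul1r lerDr ltW.
Qed.

Lemma gauge_dist x y : `|gauge x - gauge y| <= rho^-1 * enorm (x - y).
Proof.
have h1 := gauge_add y (x - y); have h2 := gauge_add x (y - x).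
rewrite addrC subrK in h1; rewrite addrC subrK (enorm_distC y x) in h2.
by rewrite ler_norml; apply/andP; split; lra.
Qed.

Lemma expansion_dist u v : enorm u = 1 -> enorm v = 1 ->
  `|s u - s v| <= Rad ^+ 2 * rho^-1 * enorm (u - v).
Proof.
move=> u1 v1; have su := expansion_gt0 u1; have sv := expansion_gt0 v1.
have -> : s u - s v = s u * s v * (gauge v - gauge u).
  by rewrite !gauge_unit//; field; rewrite !gt_eqF.
rewrite normrM gtr0_norm ?mulr_gt0// -mulrA ler_pM ?mulr_ge0// ?(ltW su) ?(ltW sv)//.
  by rewrite expr2 ler_pM ?expansion_le// ltW.
by rewrite (enorm_distC u v) gauge_dist.
Qed.

Lemma expansion_mapE x : expansion_map Omega x = s (unit_vec x) *: x.
Proof. by rewrite /expansion_map; case: eqP => // ->; rewrite scaler0. Qed.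

Lemma bilipschitz_expansion : bilipschitz (expansion_map Omega).
Proof.
have -> : expansion_map Omega = fun x => s (unit_vec x) *: x.
  by apply/funext => x; exact: expansion_mapE.
have irho : 0 <= rho^-1 by rewrite invr_ge0 ltW.
split.
  apply: (@elipschitz_radial _ _ _ Rad (Rad ^+ 2 * rho^-1)).
  - exact: ltW.
  - by rewrite mulr_ge0// sqr_ge0.
  - by move=> u u1; rewrite gtr0_norm ?expansion_gt0// expansion_le.
  - exact: expansion_dist.
exists (fun x => (s (unit_vec x))^-1 *: x); split.
- move=> x /=; have [->|x0] := eqVneq x 0; first by rewrite !scaler0.
  have s0 := expansion_gt0 (enorm_unit_vec x0).
  by rewrite unit_vecZ// scalerA mulVf ?scale1r// gt_eqF.
- move=> x /=; have [->|x0] := eqVneq x 0; first by rewrite !scaler0.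
  have s0 := expansion_gt0 (enorm_unit_vec x0).
  by rewrite unit_vecZ ?invr_gt0// scalerA mulfV ?scale1r// gt_eqF.
apply: (@elipschitz_radial _ _ (fun u => (s u)^-1) r^-1 rho^-1) => //.
- by rewrite invr_ge0 ltW.
- move=> u u1; rewrite normfV gtr0_norm ?expansion_gt0//.
  by rewrite lef_pV2 ?posrE ?expansion_gt0// expansion_ge.
- by move=> u v u1 v1; rewrite -!gauge_unit// gauge_dist.
Qed.

Lemma gauge_lipschitz : lipschitz_fun gauge (rho^-1 * n%:R).
Proof.
move=> x y; apply: le_trans (gauge_dist x y) _.
by rewrite -mulrA ler_wpM2l ?enorm_le_norm// invr_ge0 ltW.
Qed.

(** On the sphere, [v - u] is tangential at [u] up to second order. *)
Lemma dotp_unit_diff u v : enorm u = 1 -> enorm v = 1 ->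
  dotp u (v - u) = - (enorm (v - u) ^+ 2 / 2).
Proof.
move=> u1 v1; rewrite sqr_enorm dotpBl !dotpBr (dotpC v u) -!sqr_enorm u1 v1.
by field.
Qed.

(** On the sphere [s] is the inverse of the gauge, whose gradient at [x] and at
    [unit_vec x] is the same by homogeneity; the surface gradient is the
    tangential part of the gradient of the inverse. *)
Lemma surface_gradient_ex x q : x != 0 -> has_gradient gauge x q ->
  exists g, is_surface_gradient s (unit_vec x) g.
Proof.
move=> x0 xq; set u := unit_vec x; pose N := enorm x.
have u1 : enorm u = 1 by exact: enorm_unit_vec.
have N0 : 0 < N by rewrite enorm_gt0.
have su := expansion_gt0 u1; have suR := expansion_le u1.
exists (- s u ^+ 2 *: (q - dotp q u *: u)); split.
  rewrite dotpZl dotpBl dotpZl -sqr_enorm u1; ring.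
move=> e e0.
(* In the decomposition of the error made below, [e'] controls the first term, and
   [K] collects the coefficients of the two terms quadratic in [w]. *)
pose K := Rad ^+ 3 * rho^-1 ^+ 2 + Rad ^+ 2 * `|dotp q u| / 2.
have K0 : 0 <= K.
  by rewrite addr_ge0 ?mulr_ge0 ?exprn_ge0 ?invr_ge0 ?(ltW rho_gt0) ?(ltW Rad_gt0).
pose e' := e / (2 * Rad ^+ 2).
have R20 : 0 < Rad ^+ 2 by rewrite exprn_gt0.
have e'0 : 0 < e' by rewrite divr_gt0// mulr_gt0.
have [d d0 Hd] := xq _ e'0.
have K1 : 0 < 2 * K + 1 by lra.
exists (Num.min (d / N) (e / (2 * K + 1))); first by rewrite lt_min !divr_gt0.
move=> v v1; rewrite lt_min => /andP[vd vK].
have sv := expansion_gt0 v1; have svR := expansion_le v1.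
set w := v - u; have w0 : 0 <= enorm w := enorm_ge0 w.
have uw := dotp_unit_diff u1 v1; rewrite -/w in uw.
have h1 : `|gauge v - gauge u - dotp q w| <= e' * enorm w.
  have hw : `|N *: w| <= d.
    rewrite normrZ gtr0_norm// mulrC -ler_pdivlMr//.
    by apply: le_trans (norm_le_enorm _) (ltW vd).
  have := Hd _ hw.
  have -> : x + N *: w = N *: v.
    by rewrite -{1}(unit_vecK x) -/N -/u -scalerDr addrC subrK.
  have -> : gauge x = N * gauge u by rewrite -gaugeZ// unit_vecK.
  rewrite gaugeZ// dotpZr -!mulrBr normrM normrZ.
  rewrite gtr0_norm// mulrCA ler_pM2l// => /le_trans; apply.
  by rewrite ler_wpM2l ?norm_le_enorm// ltW.
have h2 := gauge_dist v u; rewrite -/w in h2.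
have h3 := expansion_dist v1 u1; rewrite -/w in h3.
have -> : s v - s u - dotp (- s u ^+ 2 *: (q - dotp q u *: u)) w =
   - (s u ^+ 2 * (gauge v - gauge u - dotp q w))
   - s u * ((s v - s u) * (gauge v - gauge u))
   + s u ^+ 2 * dotp q u * (enorm w ^+ 2 / 2).
  rewrite dotpZl dotpBl dotpZl uw !gauge_unit//; field.
  by rewrite !gt_eqF.
apply: le_trans (ler_normD _ _) _.
apply: le_trans (lerD (ler_normB _ _) (lexx _)) _.
rewrite normrN.
have su2 : s u ^+ 2 <= Rad ^+ 2 by rewrite ler_pXn2r ?nnegrE// ltW.
have b1 : `|s u ^+ 2 * (gauge v - gauge u - dotp q w)| <= Rad ^+ 2 * (e' * enorm w).
  by rewrite normrM ger0_norm ?sqr_ge0// ler_pM// sqr_ge0.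
have b2 : `|s u * ((s v - s u) * (gauge v - gauge u))| <=
    Rad * ((Rad ^+ 2 * rho^-1 * enorm w) * (rho^-1 * enorm w)).
  by rewrite normrM gtr0_norm// ler_pM ?(ltW su)// normrM ler_pM.
have b3 : `|s u ^+ 2 * dotp q u * (enorm w ^+ 2 / 2)| <=
    Rad ^+ 2 * `|dotp q u| * (enorm w ^+ 2 / 2).
  have w2 : 0 <= enorm w ^+ 2 / 2 by rewrite divr_ge0// sqr_ge0.
  rewrite normrM (ger0_norm w2) ler_wpM2r//.
  by rewrite normrM ger0_norm ?sqr_ge0// ler_wpM2r.
apply: le_trans (lerD (lerD b1 b2) b3) _.
have -> : Rad ^+ 2 * (e' * enorm w) = e / 2 * enorm w.
  by rewrite /e'; field; rewrite gt_eqF.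
have b4 : K * enorm w <= e / 2.
  have : K * enorm w <= K * (e / (2 * K + 1)) by rewrite ler_wpM2l// ltW.
  move=> /le_trans; apply; rewrite mulrA ler_pdivrMr//.
  have : 0 <= e * K by rewrite mulr_ge0// ltW.
  lra.
have : K * enorm w * enorm w <= e / 2 * enorm w by rewrite ler_wpM2r.
rewrite /K; lra.
Qed.

(** With [u] and [v] the directions of [x] and [x + h], tangentiality of [g] gives
    [dotp g (v - u) = dotp g h / enorm (x + h)], which differs from
    [dotp g h / enorm x] by a term quadratic in [h]. *)
Lemma expansion_direction_expand x g : x != 0 ->
  is_surface_gradient s (unit_vec x) g -> forall e : R, 0 < e ->
  exists2 d : R, 0 < d & forall h, enorm h <= d ->
    `|s (unit_vec (x + h)) - s (unit_vec x) - dotp g h / enorm x| <= e * enorm h.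
Proof.
move=> x0 [gu sg] e e0; set u := unit_vec x in gu sg *; pose N := enorm x.
have u1 : enorm u = 1 by exact: enorm_unit_vec.
have N0 : 0 < N by rewrite enorm_gt0.
have gx : dotp g x = 0 by rewrite -(unit_vecK x) dotpZr gu mulr0.
have e1 : 0 < e * N / 4 by rewrite divr_gt0// mulr_gt0.
have [d d0 Hd] := sg _ e1.
pose G := enorm g + 1; have G0 : 0 < G by rewrite ltr_wpDl// enorm_ge0.
exists (Num.min (N / 2) (Num.min (d * N / 4) (e * N ^+ 2 / (4 * G)))).
  by rewrite !lt_min !divr_gt0 ?mulr_gt0 ?exprn_gt0.
move=> h; rewrite !le_min => /and3P[hN hd he].
have h0 : 0 <= enorm h := enorm_ge0 h.
pose y := x + h; pose N' := enorm y.
have NN' : `|N - N'| <= enorm h.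
  by have := enorm_dist_dist x y; rewrite /y opprD addNKr enormN.
have N'2 : N / 2 <= N' by move: NN'; rewrite ler_norml => /andP[]; lra.
have N'0 : 0 < N' by lra.
have y0 : y != 0 by rewrite -enorm_gt0.
pose v := unit_vec y; have v1 : enorm v = 1 by exact: enorm_unit_vec.
have vu : enorm (v - u) * N <= 2 * enorm h.
  by rewrite -[in leRHS](_ : y - x = h) ?unit_vec_dist// /y addrC addKr.
have vd : enorm (v - u) < d.
  rewrite -(ltr_pM2r N0); apply: le_lt_trans vu _.
  have := mulr_gt0 d0 N0; lra.
have b1 := Hd v v1 vd.
have gvu : dotp g (v - u) = dotp g h / N'.
  by rewrite dotpBr gu subr0 dotpZr dotpDr gx add0r mulrC.
rewrite -/N -/y -/v.
have -> : s v - s u - dotp g h / N = (s v - s u - dotp g (v - u))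
    + dotp g h * (N - N') / (N * N').
  by rewrite gvu; field; rewrite !gt_eqF.
apply: le_trans (ler_normD _ _) _.
have b2 : e * N / 4 * enorm (v - u) <= e / 2 * enorm h.
  have : e / 4 * (enorm (v - u) * N) <= e / 4 * (2 * enorm h).
    by rewrite ler_wpM2l// divr_ge0// ltW.
  lra.
have b3 : `|dotp g h * (N - N') / (N * N')| <= e / 2 * enorm h.
  rewrite normrM normfV (gtr0_norm (mulr_gt0 N0 N'0)) ler_pdivrMr ?mulr_gt0//.
  rewrite normrM.
  apply: (@le_trans _ _ (G * enorm h * enorm h)).
    rewrite ler_pM//; apply: le_trans (cauchy_schwarz _ _) _.
    by rewrite ler_wpM2r// lerDl.
  apply: (@le_trans _ _ (e / 2 * enorm h * (N * (N / 2)))); last first.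
    rewrite ler_wpM2l ?mulr_ge0 ?divr_ge0 ?(ltW e0)//.
    by rewrite ler_wpM2l// ltW.
  rewrite -mulrA (mulrC G) -mulrA mulrAC.
  move: he; rewrite ler_pdivlMr ?mulr_gt0// => he.
  have : enorm h * (enorm h * (4 * G)) <= enorm h * (e * N ^+ 2) by rewrite ler_wpM2l.
  lra.
apply: le_trans (lerD b1 b3) _; lra.
Qed.

(** The product rule for [s (unit_vec x) *: x]: the scalar factor has differential
    [dotp g h / enorm x], and [x / enorm x] is [unit_vec x]. *)
Lemma expansion_jacobian x g : x != 0 -> is_surface_gradient s (unit_vec x) g ->
  differentiable (expansion_map Omega) x /\
  jacobian_matrix (expansion_map Omega) x =
    (s (unit_vec x))%:M + tensor (unit_vec x) g.
Proof.
move=> x0 sg; pose N := enorm x.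
have N0 : 0 < N by rewrite enorm_gt0.
pose B := ((s (unit_vec x))%:M + tensor (unit_vec x) g)^T.
have BE h : h *m B = s (unit_vec x) *: h + (dotp g h / N) *: x.
  rewrite /B linearD /= tr_scalar_mx trmx_mul trmxK mulmxDr mul_mx_scalar mulmxA.
  have -> : h *m g^T = (dotp g h)%:M.
    rewrite [LHS]mx11_scalar; congr _%:M; rewrite mxE dotpC.
    by apply: eq_bigr => i _; rewrite mxE.
  by rewrite mul_scalar_mx /unit_vec scalerA.
suff : differentiable (expansion_map Omega) x /\ jacobian (expansion_map Omega) x = B.
  by case=> dS JS; split=> //; rewrite /jacobian_matrix JS trmxK.
apply: jacobian_unique => e e0.
pose c : R := n%:R + 1; have c0 : 0 < c by rewrite ltr_wpDl.
pose e1 := e / (2 * c * N); have e10 : 0 < e1 by rewrite divr_gt0 ?mulr_gt0.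
have [d d0 Hd] := expansion_direction_expand x0 sg e10.
pose K := e1 + enorm g / N.
have K0 : 0 < K by rewrite ltr_pwDl// divr_ge0 ?enorm_ge0// ltW.
exists (Num.min (d / c) (e / (2 * c ^+ 2 * K))).
  by rewrite lt_min !divr_gt0 ?mulr_gt0 ?exprn_gt0.
move=> h; rewrite le_min => /andP[hd hK].
have ch : enorm h <= c * `|h|.
  by apply: le_trans (enorm_le_norm _) _; rewrite ler_wpM2r// lerDl.
have {}Hd := Hd h (le_trans ch _).
have {Hd} : `|s (unit_vec (x + h)) - s (unit_vec x) - dotp g h / N| <= e1 * enorm h.
  by apply: Hd; rewrite mulrC -ler_pdivlMr.
set a := _ - dotp g h / N => ha.
rewrite !expansion_mapE BE.
have -> : s (unit_vec (x + h)) *: (x + h) - s (unit_vec x) *: x -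
    (s (unit_vec x) *: h + (dotp g h / N) *: x) =
    a *: x + (a + dotp g h / N) *: h.
  rewrite /a subrK !scalerDr !scalerBl opprD.
  by apply/rowP => i; rewrite !mxE; ring.
apply: le_trans (norm_le_enorm _) _; apply: le_trans (enormD _ _) _.
rewrite !enormZ -/N.
have hab : `|a + dotp g h / N| <= K * enorm h.
  apply: le_trans (ler_normD _ _) _; rewrite mulrDl lerD//.
  rewrite normrM normfV (gtr0_norm N0) mulrAC ler_wpM2r ?invr_ge0 ?(ltW N0)//.
  exact: cauchy_schwarz.
have h0 := enorm_ge0 h.
have b1 : `|a| * N <= e / 2 * `|h|.
  have : `|a| * N <= e1 * (c * `|h|) * N.
    by rewrite ler_wpM2r ?(ltW N0)// (le_trans ha)// ler_wpM2l// ltW.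
  move=> /le_trans; apply; rewrite le_eqVlt; apply/orP; left; apply/eqP.
  by rewrite /e1; field; rewrite !gt_eqF.
have b2 : `|a + dotp g h / N| * enorm h <= e / 2 * `|h|.
  have : `|a + dotp g h / N| * enorm h <= K * (c * `|h|) * (c * `|h|).
    rewrite ler_pM// (le_trans hab)// ler_wpM2l// ltW//.
  move=> /le_trans; apply.
  have : `|h| * (2 * c ^+ 2 * K) <= e by rewrite -ler_pdivlMr ?mulr_gt0 ?exprn_gt0.
  move=> /(ler_wpM2r (normr_ge0 h)); lra.
by apply: le_trans (lerD b1 b2) _; lra.
Qed.

End StarShaped.

(** * Singular values of a rank-one perturbation of a scalar matrix *)

(** Sylvester's determinant identity, from the two triangular factorizations of
    the block matrix with rows (y, B) and (C, 1). *)
Lemma det_sylvester (K : comNzRingType) (m k : nat) (y : K)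
    (B : 'M[K]_(m, k)) (C : 'M[K]_(k, m)) :
  y ^+ k * \det (y%:M - B *m C) = y ^+ m * \det (y%:M - C *m B).
Proof.
pose P := block_mx y%:M B C 1%:M.
have -> : \det (y%:M - B *m C) = \det P.
  have -> : \det P = \det (P *m block_mx 1%:M 0 (- C) 1%:M).
    by rewrite det_mulmx det_lblock !det1 !mulr1.
  rewrite mulmx_block !mulmx1 !mulmx0 !mul1mx !mulmxN !add0r subrr.
  by rewrite det_ublock det1 mulr1.
rewrite -[y ^+ k]det_scalar -[y ^+ m]det_scalar.
have -> : \det (y%:M : 'M[K]_k) * \det P = \det (block_mx 1%:M 0 (- C) y%:M *m P).
  by rewrite det_mulmx det_lblock det1 mul1r.
rewrite mulmx_block !mulmx1 !mul1mx !mul0mx !addr0 mulNmx mul_mx_scalar mul_scalar_mx.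
by rewrite addNr det_ublock mulNmx addrC.
Qed.

Lemma det_block_scalar (K : comNzRingType) (a b c d : K) :
  \det (block_mx a%:M b%:M c%:M d%:M : 'M[K]_(1 + 1)) = a * d - b * c.
Proof.
rewrite (expand_det_row _ (lshift 1 ord0)) big_split_ord /= !big_ord1.
have l1 : @lift (1 + 1) (lshift 1 ord0) (0 : 'I_1) = rshift 1 ord0.
  exact/val_inj.
have l2 : @lift (1 + 1) (rshift 1 ord0) (0 : 'I_1) = lshift 1 ord0.
  exact/val_inj.
rewrite block_mxEul block_mxEur /cofactor !det_mx11 !mxE l1 l2.
rewrite (unsplitK (inr ord0)) row_mxEl row_mxEr !mxE /=; ring.
Qed.

Lemma monic_quadratic_factor (K : comNzRingType) (a b c d : K) :
  a + b = 2 * c + d -> a * b = c ^+ 2 ->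
  ('X - c%:P) ^+ 2 - d%:P * ('X - c%:P) - (c * d)%:P = ('X - a%:P) * ('X - b%:P).
Proof.
move=> abD abM.
have -> : ('X - a%:P) * ('X - b%:P) = 'X ^+ 2 - (a + b)%:P * 'X + (a * b)%:P.
  by rewrite polyCD polyCM; ring.
by rewrite abD abM mulr_natl mulr2n expr2 !polyCD !polyCM; ring.
Qed.

Lemma prod_extremes (K : comNzRingType) (n : nat) (a b c : K) : (1 < n)%N ->
  \prod_(i < n) (if i == 0%N :> nat then a else if i == n.-1 :> nat then b else c) =
  c ^+ n.-2 * (a * b).
Proof.
case: n => [|[|m]]// _; rewrite big_ord_recl big_ord_recr /= eqxx.
rewrite (eq_bigr (fun=> c)) => [|i _]; last first.
  by rewrite /bump /= add1n eqSS ltn_eqF.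
by rewrite prodr_const card_ord mulrCA.
Qed.

Lemma orthogonal_dim1 (R : realType) (n : nat) (u g : 'rV[R]_n) : n = 1%N ->
  enorm u = 1 -> dotp g u = 0 -> enorm g = 0.
Proof.
move=> n1; subst n => u1; rewrite /dotp big_ord1 => /eqP.
rewrite mulf_eq0 => /orP[|] /eqP z0.
  by rewrite /enorm /dotp big_ord1 z0 mul0r sqrtr0.
move: u1; rewrite /enorm /dotp big_ord1 z0 mul0r sqrtr0 => /eqP.
by rewrite eq_sym oner_eq0.
Qed.

Section SingularValues.
Variables (R : realType) (n : nat) (s : R) (u g : 'rV[R]_n).
Hypotheses (s_gt0 : 0 < s) (u1 : enorm u = 1) (gu : dotp g u = 0).

Let A := s%:M + tensor u g.
Let G := enorm g ^+ 2.

Lemma mul_rV_tr (x y : 'rV[R]_n) : x *m y^T = (dotp x y)%:M.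
Proof.
rewrite [LHS]mx11_scalar; congr _%:M; rewrite mxE.
by apply: eq_bigr => i _; rewrite mxE.
Qed.

Let scalar_mx_0 k : 0%:M = 0 :> 'M[R]_k. Proof. by rewrite raddf0. Qed.

Let ug : dotp u g = 0. Proof. by rewrite dotpC. Qed.
Let uu : dotp u u = 1. Proof. by rewrite -sqr_enorm u1 expr1n. Qed.
Let gg : dotp g g = G. Proof. by rewrite -sqr_enorm. Qed.

(** Sylvester's identity turns the rank-one term into the scalar [dotp g u = 0]. *)
Lemma det_scalar_tensor : \det A = s ^+ n.
Proof.
have := det_sylvester s (- u^T) g.
rewrite !mulNmx !mulmxN !opprK mul_rV_tr gu -[1 as X in s ^+ X]/1%N.
rewrite scalar_mx_0 addr0 det_scalar1 mulrC expr1 => /mulIf; apply.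
by rewrite gt_eqF.
Qed.

(** As [A^T *m A] differs from [(s ^+ 2)%:M] by the product of an n x 2 and a 2 x n
    matrix, Sylvester's identity leaves a 2 x 2 determinant. *)
Lemma char_poly_tensor : let y : {poly R} := 'X - (s ^+ 2)%:P in
  y ^+ 2 * char_poly (A^T *m A) =
  y ^+ n * (y ^+ 2 - G%:P * y - (s ^+ 2 * G)%:P).
Proof.
move=> y.
pose B := row_mx u^T g^T : 'M[R]_(n, 1 + 1).
pose C := col_mx (s *: g) (s *: u + g) : 'M[R]_(1 + 1, n).
have AE : A^T *m A = (s ^+ 2)%:M + B *m C.
  have -> : A^T = s%:M + g^T *m u.
    by rewrite /A /tensor linearD /= tr_scalar_mx trmx_mul trmxK.
  rewrite /A /tensor.
  rewrite mulmxDl !mulmxDr -scalar_mxM -expr2 -addrA; congr (_ + _).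
  rewrite mul_row_col -!scalemxAr mulmxDr -scalemxAr mul_scalar_mx mul_mx_scalar.
  congr (_ + (_ + _)).
  by rewrite mulmxA -[_ *m u *m _]mulmxA mul_rV_tr uu mulmx1.
have cE : char_poly (A^T *m A) = \det (y%:M - map_mx polyC B *m map_mx polyC C).
  rewrite /char_poly /char_poly_mx AE map_mxD map_scalar_mx -map_mxM /=.
  by rewrite opprD addrA /y raddfB.
rewrite cE [LHS](@det_sylvester _ n (1 + 1) y); congr (_ * _).
have -> : map_mx polyC C *m map_mx polyC B =
    block_mx 0 ((s * G)%:P)%:M (s%:P)%:M (G%:P)%:M.
  rewrite -map_mxM (_ : C *m B = block_mx 0 (s * G)%:M s%:M G%:M).
    by rewrite map_block_mx !map_scalar_mx map_mx0.
  rewrite /C /B mul_col_row -!scalemxAl !mulmxDl -!scalemxAl !mul_rV_tr.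
  rewrite gu ug uu gg !scalar_mx_0 scaler0 add0r addr0.
  by rewrite -!mul_scalar_mx -!scalar_mxM mulr1.
rewrite scalar_mx_block opp_block_mx add_block_mx.
rewrite subr0 !sub0r -!(raddfN (@scalar_mx _ 1)) -(raddfD (@scalar_mx _ 1)) det_block_scalar.
by rewrite !polyCM; ring.
Qed.


Let D := Num.sqrt (4 * s ^+ 2 + G).
Let sigma_max := 2^-1 * (D + enorm g).
Let sigma_min := 2^-1 * (D - enorm g).

Let D2 : D ^+ 2 = 4 * s ^+ 2 + enorm g ^+ 2.
Proof. by rewrite sqr_sqrtr// addr_ge0 //; [rewrite mulr_ge0 ?sqr_ge0|exact: sqr_ge0]. Qed.

Let sigma_order : [/\ 0 <= sigma_min, sigma_min <= s & s <= sigma_max].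
Proof.
have D0 : 0 <= D := sqrtr_ge0 _; have g0 := enorm_ge0 g.
have s2 : 0 < s ^+ 2 by rewrite exprn_gt0.
have h1 : enorm g <= D.
  by rewrite -(ler_pXn2r (n:=2)) ?nnegrE// D2; lra.
have h2 : D <= 2 * s + enorm g.
  have sg : 0 <= s * enorm g by rewrite mulr_ge0// ltW.
  by rewrite -(ler_pXn2r (n:=2)) ?nnegrE ?addr_ge0 ?mulr_ge0 ?(ltW s_gt0)// D2; lra.
have h3 : 2 * s <= D.
  have sg := sqr_ge0 (enorm g).
  by rewrite -(ler_pXn2r (n:=2)) ?nnegrE ?mulr_ge0 ?(ltW s_gt0)// D2; lra.
by rewrite /sigma_min /sigma_max; split; lra.
Qed.

Let quadratic_factor : let y : {poly R} := 'X - (s ^+ 2)%:P in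
  y ^+ 2 - G%:P * y - (s ^+ 2 * G)%:P =
  ('X - (sigma_max ^+ 2)%:P) * ('X - (sigma_min ^+ 2)%:P).
Proof.
move=> y; pose a := sigma_max ^+ 2; pose b := sigma_min ^+ 2.
have ab1 : a + b = 2 * s ^+ 2 + G.
  have := D2; rewrite /a /b /sigma_max /sigma_min /G; lra.
have ab2 : a * b = (s ^+ 2) ^+ 2.
  have -> : a * b = (4^-1 * (D ^+ 2 - enorm g ^+ 2)) ^+ 2.
    by rewrite /a /b /sigma_max /sigma_min; field.
  by rewrite D2; congr (_ ^+ 2); field.
exact: monic_quadratic_factor.
Qed.

(** The product of [sigma_max] and [sigma_min] is [s ^+ 2], and the sum of their
    squares is [2 * s ^+ 2 + enorm g ^+ 2], which factors the quadratic left by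
    [char_poly_tensor]. In dimension 1 the vector [g], orthogonal to [u], is 0 and
    the two values coincide with [s]. *)
Lemma tensor_singular_values : (0 < n)%N ->
  exists2 sigma : 'I_n -> R, is_singular_values A sigma &
    forall i : 'I_n, [/\ i = 0%N :> nat -> sigma i = sigma_max,
      (0 < i < n.-1)%N -> sigma i = s & i = n.-1 :> nat -> sigma i = sigma_min].
Proof.
move=> n0.
have [s0 sn s1] := sigma_order.
pose sigma (i : 'I_n) := if i == 0%N :> nat then sigma_max
  else if i == n.-1 :> nat then sigma_min else s.
have single : n = 1%N -> sigma_min = sigma_max.
  move=> n1; rewrite /sigma_min /sigma_max.
  by rewrite (orthogonal_dim1 n1 u1 gu) subr0 addr0.
exists sigma; last first.
  move=> i; rewrite /sigma; split=> [->//|/andP[i0 ilt]|->].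
    by rewrite gtn_eqF// ltn_eqF.
  rewrite eqxx; case: eqP => // n10; rewrite single//.
  by rewrite -(prednK n0) n10.
split.
- by move=> i; rewrite /sigma; case: ifP => _; [|case: ifP => _ //]; lra.
- move=> i j ij; rewrite /sigma; case: (eqVneq (i : nat) 0%N) => [i0|i0].
    by case: ifP => _ //; case: ifP => _; lra.
  have j0 : j != 0%N :> nat by rewrite -lt0n (leq_trans _ ij)// lt0n.
  rewrite (negbTE j0); case: (eqVneq (i : nat) n.-1) => [ni|ni].
    have -> : j = n.-1 :> nat; last by rewrite eqxx.
    apply/eqP; rewrite eqn_leq -{2}ni ij andbT.
    by rewrite -ltnS prednK// ltn_ord.
  by case: ifP.
have := char_poly_tensor; rewrite /= quadratic_factor.
set y := 'X - (s ^+ 2)%:P => cpE.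
have y0 k : y ^+ k != 0 by rewrite expf_neq0// polyXsubC_eq0.
have prodE : \prod_(i < n) ('X - (sigma i ^+ 2)%:P) =
    \prod_(i < n) (if i == 0%N :> nat then 'X - (sigma_max ^+ 2)%:P
      else if i == n.-1 :> nat then 'X - (sigma_min ^+ 2)%:P else y).
  by apply: eq_bigr => i _; rewrite /sigma; do 2?case: ifP.
have [n1|n1] := leqP n 1; last first.
  rewrite prodE prod_extremes//; apply: (mulfI (y0 2)); rewrite cpE [RHS]mulrA -exprD.
  by congr (y ^+ _ * _); case: (n) n1 => [|[|m]].
have {n1} n1 : n = 1%N by apply/eqP; rewrite eqn_leq n1.
have maxE : sigma_max = s by apply/le_anti; rewrite s1 -single// sn.
apply: (mulfI (y0 2)); rewrite cpE {1}n1 single// maxE -/y expr1 -expr2 mulrC.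
rewrite (eq_bigr (fun=> y)) => [|i _]; last first.
  rewrite /sigma; have -> : i = 0%N :> nat; last by rewrite eqxx maxE.
  by apply/eqP; rewrite -leqn0 -ltnS -n1 ltn_ord.
by rewrite prodr_const card_ord n1.
Qed.


End SingularValues.

(** * The expansion transformation *)

Theorem theorem2p17 (R : realType) (n : nat) (n_gt0 : (0 < n)%N)
    (rho r Rad : R) (rho_gt0 : 0 < rho) (rho_le_r : rho <= r)
    (r_le_Rad : r <= Rad) (Omega : set 'rV[R]_n)
    (openO : open Omega) (connO : connected Omega)
    (O_sub : Omega `<=` eball n Rad) (sub_O : eball n r `<=` Omega)
    (starO : star_shaped (eball n rho) Omega) :
  let s := expansion_fun Omega in
  let S := expansion_map Omega in
  let J := jacobian_matrix S in
  let grad := surface_gradient s in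
  [/\ bilipschitz S,
      lebesgue_ae (fun x =>
        [/\ is_surface_gradient s (unit_vec x) (grad (unit_vec x)),
            differentiable S x &
            J x = (s (unit_vec x))%:M
                  + tensor (unit_vec x) (grad (unit_vec x))]),
      lebesgue_ae (fun x =>
        exists2 sigma : 'I_n -> R, is_singular_values (J x) sigma &
          forall i : 'I_n,
          [/\ i = 0%N :> nat ->
                sigma i = 2^-1 * (Num.sqrt (4 * s (unit_vec x) ^+ 2
                                       + enorm (grad (unit_vec x)) ^+ 2)
                                  + enorm (grad (unit_vec x))),
              (0 < i < n.-1)%N -> sigma i = s (unit_vec x) &
              i = n.-1 :> nat ->
                sigma i = 2^-1 * (Num.sqrt (4 * s (unit_vec x) ^+ 2
                                       + enorm (grad (unit_vec x)) ^+ 2)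
                                  - enorm (grad (unit_vec x)))]) &
      lebesgue_ae (fun x => \det (J x) = s (unit_vec x) ^+ n)].
Proof.
move=> s S J grad.
have Lip := gauge_lipschitz rho_gt0 rho_le_r O_sub sub_O starO.
have L0 : 0 <= rho^-1 * n%:R by rewrite mulr_ge0// invr_ge0 ltW.
(* All four assertions hold, by pointwise arguments, at the nonzero points where
   the gauge has a gradient. *)
pose good x := x != 0 /\ exists q, has_gradient (gauge Omega) x q.
have good_ae (P : 'rV[R]_n -> Prop) : (forall x, good x -> P x) -> lebesgue_ae P.
  move=> goodP; apply: (@lebesgue_nullS _ _ _
    ([set 0] `|` [set x | ~ exists q, has_gradient (gauge Omega) x q])).
    move=> x nPx; apply: contrapT => /not_orP[/eqP x0 /contrapT xq].
    by apply: nPx; apply: goodP.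
  by apply: lebesgue_nullU; [exact: lebesgue_null1|exact: rademacher Lip].
have good_grad x : good x -> is_surface_gradient s (unit_vec x) (grad (unit_vec x)).
  move=> [x0 [q xq]]; apply: (@xgetPex _ 0 [set g | is_surface_gradient s (unit_vec x) g]).
  have [g sg] := surface_gradient_ex rho_gt0 rho_le_r r_le_Rad O_sub sub_O starO x0 xq.
  by exists g.
have good_jac x : good x -> differentiable S x /\
    J x = (s (unit_vec x))%:M + tensor (unit_vec x) (grad (unit_vec x)).
  move=> gx; have [x0 _] := gx.
  exact: expansion_jacobian x0 (good_grad x gx).
have good_s x : good x -> 0 < s (unit_vec x).
  case=> x0 _; exact: (expansion_gt0 rho_gt0 rho_le_r O_sub sub_O (enorm_unit_vec x0)).
split.
- exact: (bilipschitz_expansion rho_gt0 rho_le_r r_le_Rad O_sub sub_O starO).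
- by apply: good_ae => x gx; have [dS JE] := good_jac x gx; split=> //; exact: good_grad.
- apply: good_ae => x gx; have [dS ->] := good_jac x gx; have [x0 _] := gx.
  have [gu _] := good_grad x gx.
  exact: (tensor_singular_values (good_s x gx) (enorm_unit_vec x0) gu n_gt0).
- apply: good_ae => x gx; have [dS ->] := good_jac x gx; have [x0 _] := gx.
  have [gu _] := good_grad x gx.
  exact: (det_scalar_tensor (good_s x gx) gu).
Qed.
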